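(* Let the step-size sequence $\{\alpha^t\}_{t\ge 0}$, with each $\alpha^t\ge 0$, satisfy $\sum_{t=0}^\infty \alpha^t=\infty$ and $\sum_{t=0}^\infty(\alpha^t)^2<\infty$. Let $\sigma\in\mathbb{R}^S$, $\sigma\ge 0$, be such that the restricted problem $\mathrm{LP}(\sigma)$ is feasible, and let the local allocation vectors $y_i^0\in\mathbb{R}^S$ be initialized such that $\sum_{i=1}^N y_i^0=b-\sigma$. Then, for a sufficiently large $M>0$, the distributed algorithm described in the context generates an allocation vector sequence $\{y_1^t,\ldots,y_N^t\}_{t\ge0}$ and a primal sequence $\{z_1^t,\ldots,z_N^t\}_{t\ge 0}$ (where $z_i^t$ is the $z_i$-part of an optimal solution of the local problem $\mathrm{Loc}_i(y_i^t)$, for all $t\ge 0$) such that: (i) $\sum_{i=1}^N y_i^t=b-\sigma$ for all $t\ge 0$; (ii) $\lim_{t\to\infty}\|y_i^t-y_i^\star\|=0$ for all $i\in\{1,\ldots,N\}$, where $(y_1^\star,\ldots,y_N^\star)$ is an optimal solution of the master problem $\mathrm{Master}(\sigma)$; (iii) every limit point of $\{z_1^t,\ldots,z_N^t\}_{t\ge0}$ is an optimal (feasible) solution of $\mathrm{LP}(\sigma)$.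
   Context: Setting. There are $N$ agents and $S$ linear coupling constraints (the regime of interest is $N\gg S$; no quantitative relation is imposed). For each $i\in\{1,\ldots,N\}$: $X_i=P_i\cap(\mathbb{Z}^{p_i}\times\mathbb{R}^{q_i})$ with $P_i\subset\mathbb{R}^{p_i+q_i}$ a nonempty compact polyhedron, $c_i\in\mathbb{R}^{p_i+q_i}$, $A_i\in\mathbb{R}^{S\times(p_i+q_i)}$; and $b\in\mathbb{R}^S$. The target MILP is: minimize $\sum_{i=1}^N c_i^\top x_i$ subject to $\sum_{i=1}^N A_ix_i\le b$ and $x_i\in X_i$ for all $i$; it is assumed feasible. Vector inequalities are componentwise, $\mathbf{1}$ is the vector of ones, and $\mathrm{conv}(X_i)$ is the convex hull of $X_i$. Restricted problem $\mathrm{LP}(\sigma)$: minimize $\sum_{i=1}^N c_i^\top z_i$ over $z_1,\dots,z_N$ subject to $\sum_{i=1}^N A_iz_i\le b-\sigma$ and $z_i\in\mathrm{conv}(X_i)$ for all $i$. Master problem $\mathrm{Master}(\sigma)$: minimize $\sum_{i=1}^N \pi_i(y_i)$ over $y_1,\dots,y_N\in\mathbb{R}^S$ subject to $\sum_{i=1}^N y_i=b-\sigma$ and $y_i\in Y_i$ for all $i$, where $\pi_i(y_i)=\min\{c_i^\top z_i : A_iz_i\le y_i,\ z_i\in\mathrm{conv}(X_i)\}$ and $Y_i$ is the set of $y_i\in\mathbb{R}^S$ for which this minimization is feasible. Communication graph: agents communicate over a connected undirected graph on $\{1,\ldots,N\}$; $\mathcal{N}_i$ is the set of neighbors of $i$.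 Local problem $\mathrm{Loc}_i(y_i)$, for a parameter $M>0$: minimize $c_i^\top z_i+Mv_i$ over $(z_i,v_i)$ subject to $A_iz_i\le y_i+v_i\mathbf{1}$, $z_i\in\mathrm{conv}(X_i)$, $v_i\ge 0$, with $v_i\in\mathbb{R}$. Distributed algorithm: at each iteration $t\ge 0$, each agent $i$ computes a Lagrange multiplier $\mu_i^t$ of $\mathrm{Loc}_i(y_i^t)$ associated with the constraint $A_iz_i\le y_i^t+v_i\mathbf{1}$, receives $\mu_j^t$ from $j\in\mathcal{N}_i$, and updates $y_i^{t+1}=y_i^t+\alpha^t\sum_{j\in\mathcal{N}_i}(\mu_i^t-\mu_j^t)$. *)

(* Defs.v *)
From mathcomp Require Export all_boot all_order all_algebra.
From mathcomp Require Export all_classical all_reals all_analysis.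
Export Order.TTheory GRing.Theory Num.Theory.
Export numFieldNormedType.Exports.

Set Implicit Arguments.
Unset Strict Implicit.
Unset Printing Implicit Defensive.

Local Open Scope classical_set_scope.
Local Open Scope ring_scope.

Definition lev (R : realType) (n : nat) (x y : 'cV[R]_n) : Prop :=
  forall j : 'I_n, x j 0 <= y j 0.

Definition dot (R : realType) (n : nat) (x y : 'cV[R]_n) : R :=
  \sum_(j < n) x j 0 * y j 0.

(* The library norm on matrices is the sup norm. *)
Definition enorm (R : realType) (n : nat) (x : 'cV[R]_n) : R :=
  Num.sqrt (\sum_(j < n) x j 0 ^+ 2).

Definition is_minimizer (R : realType) (T : Type) (D : set T) (f : T -> R)
    (x : T) : Prop :=
  D x /\ forall x', D x' -> f x <= f x'.

Definition polyhedron (R : realType) (n : nat) (P : set 'cV[R]_n) : Prop :=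
  exists m : nat, exists D : 'M[R]_(m, n), exists d : 'cV[R]_m,
    P = [set x | lev (D *m x) d].

(* P `&` (Z^p x R^q): the first p coordinates are integers. *)
Definition mixed_integer (R : realType) (p q : nat) (P : set 'cV[R]_(p + q)) :
    set 'cV[R]_(p + q) :=
  [set x | P x /\ forall j : 'I_p, x (lshift q j) 0 \is a Num.int].

Definition conv_hull (R : realType) (n : nat) (X : set 'cV[R]_n) :
    set 'cV[R]_n :=
  smallest (@convex_set R 'cV[R]_n) X.

(* One agent: constraint set X in R^n, cost vector c, coupling matrix A. *)
Section OneAgent.
Context (R : realType) (S n : nat).
Variables (X : set 'cV[R]_n) (c : 'cV[R]_n) (A : 'M[R]_(S, n)).

Definition pi_feasible (y : 'cV[R]_S) : set 'cV[R]_n :=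
  [set z | conv_hull X z /\ lev (A *m z) y].

Definition Yset : set 'cV[R]_S := [set y | pi_feasible y !=set0].

(* For y in Yset and X compact the infimum is attained, i.e. it is the minimum;
   pi_val is only used on Yset. *)
Definition pi_val (y : 'cV[R]_S) : R :=
  inf [set dot c z | z in pi_feasible y].

Definition loc_feasible (y : 'cV[R]_S) : set ('cV[R]_n * R) :=
  [set zv | [/\ conv_hull X zv.1, 0 <= zv.2
                & lev (A *m zv.1) (y + const_mx zv.2)]].

Definition loc_cost (M : R) (zv : 'cV[R]_n * R) : R := dot c zv.1 + M * zv.2.

Definition loc_optimal (M : R) (y : 'cV[R]_S) (zv : 'cV[R]_n * R) : Prop :=
  is_minimizer (loc_feasible y) (loc_cost M) zv.

(* Only the constraint A z <= y + v 1 is dualized. *)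
Definition loc_lagrangian (M : R) (y mu : 'cV[R]_S) (zv : 'cV[R]_n * R) : R :=
  loc_cost M zv + dot mu (A *m zv.1 - (y + const_mx zv.2)).

(* mu >= 0 and the infimum of the Lagrangian over the constraints that are not
   dualized equals the optimal value. The infima are taken in \bar R so that an
   unbounded Lagrangian has infimum -oo. *)
Definition loc_multiplier (M : R) (y mu : 'cV[R]_S) : Prop :=
  lev 0 mu /\
  ereal_inf [set (loc_lagrangian M y mu zv)%:E |
               zv in [set zv | conv_hull X zv.1 /\ 0 <= zv.2]]
  = ereal_inf [set (loc_cost M zv)%:E | zv in loc_feasible y].

End OneAgent.

Section Network.
Context (R : realType) (N S : nat) (n : 'I_N -> nat).
Variables (X : forall i, set 'cV[R]_(n i)) (c : forall i, 'cV[R]_(n i)).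
Arguments X : clear implicits.
Variables (A : forall i, 'M[R]_(S, n i)) (b : 'cV[R]_S).

Definition milp_feasible : set (forall i, 'cV[R]_(n i)) :=
  [set x | lev (\sum_i A i *m x i) b /\ forall i, X i (x i)].

Definition lp_feasible (sigma : 'cV[R]_S) : set (forall i, 'cV[R]_(n i)) :=
  [set z | lev (\sum_i A i *m z i) (b - sigma) /\
           forall i, conv_hull (X i) (z i)].

Definition lp_optimal (sigma : 'cV[R]_S) (z : forall i, 'cV[R]_(n i)) : Prop :=
  is_minimizer (lp_feasible sigma) (fun z => \sum_i dot (c i) (z i)) z.

Definition master_feasible (sigma : 'cV[R]_S) : set ('I_N -> 'cV[R]_S) :=
  [set y | \sum_i y i = b - sigma /\ forall i, Yset (X i) (A i) (y i)].

Definition master_optimal (sigma : 'cV[R]_S) (y : 'I_N -> 'cV[R]_S) : Prop :=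
  is_minimizer (master_feasible sigma)
    (fun y => \sum_i pi_val (X i) (c i) (A i) (y i)) y.

(* (y, mu, z) is an execution of the algorithm over the graph e from y0. The
   choice among several multipliers or several optimal solutions of the local
   problems is left free. *)
Definition algorithm_run (e : rel 'I_N) (M : R) (alpha : nat -> R)
    (y0 : 'I_N -> 'cV[R]_S) (y mu : nat -> 'I_N -> 'cV[R]_S)
    (z : nat -> forall i, 'cV[R]_(n i)) : Prop :=
  [/\ forall i, y 0%N i = y0 i,
      forall t i, loc_multiplier (X i) (c i) (A i) M (y t i) (mu t i),
      forall t i, exists v : R,
        loc_optimal (X i) (c i) (A i) M (y t i) (z t i, v)
    & forall t i,
        y t.+1 i = y t i + alpha t *: \sum_(j | e i j) (mu t i - mu t j)].

(* Convergence in the product space is convergence of every component. *)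
Definition seq_limit_point (z : nat -> forall i, 'cV[R]_(n i))
    (zbar : forall i, 'cV[R]_(n i)) : Prop :=
  exists phi : nat -> nat,
    {homo phi : k l / (k < l)%N} /\
    forall i, z (phi k) i @[k --> \oo] --> zbar i.

End Network.

(* Main.v *)
From mathcomp Require Import ring lra.
Require Import Defs.

Set Implicit Arguments.
Unset Strict Implicit.
Unset Printing Implicit Defensive.

Local Open Scope classical_set_scope.
Local Open Scope ring_scope.

(** The hull K_i of the mixed-integer set of agent i is a polytope, so the
restricted problem is a genuine linear program: it has a solution together
with a multiplier nu of the coupling constraint, even when no point satisfies
that constraint strictly ([mixed_integer_hull], [network_duality]).  Both facts
are consequences of Farkas' lemma.

The threshold for M is 1 + sum_s nu_s.  Let phi_i (y_i) be the optimal value of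
the local problem and opt that of the restricted problem.  A total violation
sum_i v_i relaxes the coupling constraint by at most that much in every
coordinate, which lowers the cost by at most (sum_s nu_s) sum_i v_i, whereas
the penalty charges M sum_i v_i.  Hence, over the allocations y of b - sigma,
sum_i phi_i (y_i) >= opt + sum_i v_i ([exact_penalty]).  The value opt is
reached by an allocation built from a solution of the restricted problem, and
an allocation that reaches it has no violation, so that phi_i and the value of
the master subproblem agree there: such allocations are master-optimal
([optimal_allocation], [master_optimal_val]).

A multiplier mu_i at y_i is the opposite of a subgradient of phi_i, with
coordinates in [0, M] ([loc_subgradient], [loc_multiplier_bound]).  The update
adds to y a multiple of the graph Laplacian of mu, which is no Euclidean
subgradient step in y.  It becomes one in the space of edge flows x, after the
substitution y = y0 + div x: the adjoint of the divergence is the discrete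
gradient, and the divergence of the gradient is the Laplacian.  On a connected
graph every allocation of b - sigma has the form y0 + div x
([divergence_surj]).  The usual analysis of diminishing steps then applies: up
to summable errors the distance of x to every minimizing flow decreases, and
the gap sum_i phi_i (y_i) - opt is small infinitely often; a cluster point of
such flows is a minimizer, and the whole sequence converges to it
([quasi_fejer_cvg]).

Since y converges to a minimizer and the multipliers are bounded, the gap tends
to 0.  By [exact_penalty] it bounds the violations, and it also bounds the
excess of the cost of z over opt; so the limit points of z are feasible for the
restricted problem and have cost at most opt ([run_limit_point]). *)

(** * Farkas' lemma and linear programs *)

Section Scalar.
Context (R : realType) (V : lmodType R).
Implicit Types f g : V -> R.

Lemma scalar0 f : scalar f -> f 0 = 0.
Proof. by move=> h; have := h 1 0 0; rewrite scaler0 addr0 mul1r; lra. Qed.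

Lemma scalarD f u v : scalar f -> f (u + v) = f u + f v.
Proof. by move=> h; have := h 1 u v; rewrite scale1r mul1r. Qed.

Lemma scalarZ f k u : scalar f -> f (k *: u) = k * f u.
Proof. by move=> h; have := h k u 0; rewrite (scalar0 h) !addr0. Qed.

Lemma scalar_sum f (I : Type) (r : seq I) (F : I -> V) : scalar f ->
  f (\sum_(i <- r) F i) = \sum_(i <- r) f (F i).
Proof.
move=> h; elim: r => [|i r IH]; first by rewrite !big_nil scalar0.
by rewrite !big_cons scalarD // IH.
Qed.

Lemma scalar_comb f g k : scalar f -> scalar g -> scalar (fun w => f w + k * g w).
Proof. by move=> hf hg a u v; rewrite hf hg; ring. Qed.

End Scalar.

(** Induction on the constraints, following Bartl: if f can be positive once the
constraint k is dropped, this happens at some w0 that violates only k; the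
projection along w0 onto the kernel of a k eliminates this constraint, and its
multiplier is then read off at w0. *)
Lemma farkas_seq (R : realType) (V : lmodType R) (I : eqType) (r : seq I)
    (a : I -> V -> R) (f : V -> R) :
  (forall i, scalar (a i)) -> scalar f -> uniq r ->
  (forall w, (forall i, i \in r -> a i w <= 0) -> f w <= 0) ->
  exists u : I -> R, (forall i, 0 <= u i) /\
    forall w, f w = \sum_(i <- r) u i * a i w.
Proof.
elim: r a f => [|k r IH] a f sa sf.
  move=> _ h; exists (fun=> 0); split => // w; rewrite big_nil.
  have h1 : f w <= 0 by apply: h.
  have h2 : f (-1 *: w) <= 0 by apply: h.
  by rewrite (scalarZ _ _ sf) in h2; lra.
move=> /= /andP[kr ur] h.
have [h'|] := pselect (forall w, (forall i, i \in r -> a i w <= 0) -> f w <= 0).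
  have [u [u0 fu]] := IH a f sa sf ur h'.
  exists (fun i => if i == k then 0 else u i); split=> [i|w].
    by case: ifP.
  rewrite big_cons eqxx mul0r add0r fu; apply: eq_big_seq => i ir.
  by case: eqP => // ik; rewrite -ik ir in kr.
move=> /existsNP[w1 /not_implyP[aw1 /negP]]; rewrite -ltNge => fw1.
have akw1 : 0 < a k w1.
  rewrite ltNge; apply/negP => akw1; move: fw1; rewrite ltNge => /negP; apply.
  by apply: h => i; rewrite inE => /orP[/eqP ->|/aw1].
pose w0 := (a k w1)^-1 *: w1.
have akw0 : a k w0 = 1 by rewrite (scalarZ _ _ (sa k)) mulVf // gt_eqF.
have aw0 i : i \in r -> a i w0 <= 0.
  by move=> /aw1 h1; rewrite (scalarZ _ _ (sa i)) pmulr_rle0 // invr_gt0.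
have fw0 : 0 < f w0 by rewrite (scalarZ _ _ sf) mulr_gt0 // invr_gt0.
(* Projecting along w0 onto the kernel of a k removes the constraint a k. *)
have [|||u [u0 fu]] := IH (fun i w => a i w + - a i w0 * a k w)
    (fun w => f w + - f w0 * a k w) _ _ ur.
- by move=> i; apply: scalar_comb.
- exact: scalar_comb.
- move=> w aw; have := h (- a k w *: w0 + w); rewrite sf => h1.
  suff : - a k w * f w0 + f w <= 0 by lra.
  apply: h1 => i; rewrite inE sa => /orP[/eqP ->|ir].
    by rewrite akw0; lra.
  by have := aw i ir; lra.
exists (fun i => if i == k then f w0 - \sum_(j <- r) u j * a j w0 else u i).
split=> [i|w].
  case: ifP => // _; rewrite subr_ge0; apply: le_trans (ltW fw0).
  by rewrite big_seq; apply: sumr_le0 => j jr; rewrite mulr_ge0_le0 // aw0.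
rewrite big_cons eqxx.
rewrite [X in _ = _ + X](_ : _ = \sum_(i <- r) u i * a i w); last first.
  by apply: eq_big_seq => i ir; case: eqP => // ik; rewrite -ik ir in kr.
have -> : f w = \sum_(i <- r) u i * (a i w - a i w0 * a k w) + f w0 * a k w.
  rewrite (eq_bigr (fun i => u i * (a i w + - a i w0 * a k w))) -?fu; first ring.
  by move=> i _; ring.
under eq_bigr do rewrite mulrBr mulrA.
by rewrite sumrB -mulr_suml; ring.
Qed.

Lemma farkas (R : realType) (V : lmodType R) (I : finType) (P : pred I)
    (a : I -> V -> R) (f : V -> R) :
  (forall i, scalar (a i)) -> scalar f ->
  (forall w, (forall i, P i -> a i w <= 0) -> f w <= 0) ->
  exists u : I -> R, (forall i, 0 <= u i) /\
    forall w, f w = \sum_(i | P i) u i * a i w.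
Proof.
move=> sa sf h.
have [|w aw|u [u0 fu]] := @farkas_seq R V I (enum P) a f sa sf.
- exact: enum_uniq.
- by apply: h => i Pi; apply: aw; rewrite mem_enum.
by exists u; split => // w; rewrite fu big_enum.
Qed.

Lemma big_option (R : realType) (I : finType) (F : option I -> R) :
  \sum_o F o = F None + \sum_i F (Some i).
Proof.
rewrite (bigD1 None) //= (reindex_omap Some id) /=; last by case.
by congr (_ + _); apply: eq_bigl => i; rewrite eqxx.
Qed.

Section LinearProgram.
Context (R : realType) (V : lmodType R) (I J : finType).
Variables (g : I -> V -> R) (gamma : I -> R) (h : J -> V -> R) (eta : J -> R).
Variable f : V -> R.
Hypothesis (sg : forall i, scalar (g i)) (sh : forall j, scalar (h j)).
Hypothesis sf : scalar f.

Let sndE (a : R) (u v : V * R^o) : (a *: u + v).2 = a * (u.2 : R) + v.2 :> R.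
Proof. by []. Qed.

Let fstI (l : V -> R) : scalar l -> forall k,
  scalar (fun w : V * R^o => l w.1 + k * (w.2 : R)).
Proof.
move=> s k a u v; rewrite s sndE; ring.
Qed.

(** Partial duality: only the constraints h are moved into the objective.  Farkas'
lemma is applied to the homogenized program in (w, t) with t >= 0; at t = 0 its
hypothesis says that f is nonnegative on the recession directions. *)
Lemma lp_multiplier (opt : R) (w0 : V) :
  (forall i, g i w0 <= gamma i) -> (forall j, h j w0 <= eta j) ->
  (forall w, (forall i, g i w <= gamma i) -> (forall j, h j w <= eta j) ->
     opt <= f w) ->
  exists mu : J -> R, (forall j, 0 <= mu j) /\
    forall w, (forall i, g i w <= gamma i) ->
      opt <= f w + \sum_j mu j * (h j w - eta j).
Proof.
move=> gw0 hw0 fopt.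
pose a (k : option (I + J)) (w : V * R^o) : R := let t : R := w.2 in match k with
  | None => - t
  | Some (inl i) => g i w.1 + - gamma i * t
  | Some (inr j) => h j w.1 + - eta j * t end.
have [||w aw|u [u0 fu]] := @farkas R (V * R^o)%type _ predT a
    (fun w => opt * (w.2 : R) - f w.1).
- case=> [[i|j]|]; [exact: fstI|exact: fstI|].
  by move=> k x y; rewrite /a sndE; ring.
- by move=> k x y; rewrite sf sndE; ring.
- have w2 : 0 <= w.2 by have := aw None isT; rewrite /= oppr_le0.
  have ga i : g i w.1 <= gamma i * w.2 by have := aw (Some (inl i)) isT => /=; lra.
  have ha j : h j w.1 <= eta j * w.2 by have := aw (Some (inr j)) isT => /=; lra.
  move: w2; rewrite le_eqVlt => /orP[/eqP w2|w2].
    rewrite -w2 mulr0 sub0r oppr_le0 leNgt; apply/negP => fw.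
    (* A recession direction along which f decreases would beat opt from w0. *)
    have [k k0 kw] : exists2 k : R, 0 <= k & k * f w.1 + f w0 < opt.
      exists (`|opt - f w0| / - f w.1 + 1 / - f w.1).
        by rewrite addr_ge0 // divr_ge0 // ?oppr_ge0 ltW.
      rewrite -mulrDl -mulrA invrN mulNr mulVf ?lt_eqF //.
      by have := ler_norm (f w0 - opt); rewrite distrC; lra.
    suff : opt <= f (k *: w.1 + w0) by rewrite sf leNgt kw.
    apply: fopt => l; rewrite ?sg ?sh.
      have := ga l; rewrite -w2 mulr0 => g1.
      by have := mulr_ge0_le0 k0 g1; have := gw0 l; lra.
    have := ha l; rewrite -w2 mulr0 => g1.
    by have := mulr_ge0_le0 k0 g1; have := hw0 l; lra.
  have := fopt (w.2^-1 *: w.1); rewrite (scalarZ _ _ sf) => H.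
  suff : opt <= w.2^-1 * f w.1 by rewrite ler_pdivlMl //; lra.
  by apply: H => k; rewrite scalarZ // ler_pdivrMl // mulrC.
exists (fun j => u (Some (inr j))); split=> // w gw.
have := fu (w, 1 : R^o); rewrite /= big_option /= big_sumType /= !mulr1.
have -> : \sum_j u (Some (inr j)) * (h j w + - eta j * 1) =
   \sum_j u (Some (inr j)) * (h j w - eta j).
  by apply: eq_bigr => j _; rewrite mulr1.
have : \sum_i u (Some (inl i)) * (g i w + - gamma i * 1) <= 0.
  by apply: sumr_le0 => i _; rewrite mulr_ge0_le0 // mulr1 subr_le0.
by have := u0 None; lra.
Qed.

(** If no feasible point reached the infimum, then adding f <= inf to the
constraints would give an infeasible system; Farkas' lemma certifies this by a
combination whose weight on f is positive, and the certificate keeps f above the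
infimum by the inverse of this weight. *)
Lemma lp_attained (lb : R) (w0 : V) :
  (forall i, g i w0 <= gamma i) ->
  (forall w, (forall i, g i w <= gamma i) -> lb <= f w) ->
  exists w, (forall i, g i w <= gamma i) /\
    forall w', (forall i, g i w' <= gamma i) -> f w <= f w'.
Proof.
move=> gw0 flb.
pose A := [set f w | w in [set w | forall i, g i w <= gamma i]].
have infA : has_inf A.
  by split; [exists (f w0), w0|exists lb => _ [w gw <-]; exact: flb].
have A_lb w : (forall i, g i w <= gamma i) -> inf A <= f w.
  by move=> gw; apply: ge_inf; [exact: infA.2|exists w].
have [[w [gw fw]]|noopt] := pselect (exists w, (forall i, g i w <= gamma i) /\
    f w <= inf A).
  by exists w; split=> // w' /A_lb; apply: le_trans.
pose a (k : option I) (w : V * R^o) : R := let t : R := w.2 in match k with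
  | None => f w.1 + - inf A * t
  | Some i => g i w.1 + - gamma i * t end.
have [||w aw|u [u0 fu]] := @farkas R (V * R^o)%type _ predT a (fun w => w.2 : R).
- by case=> [i|]; exact: fstI.
- by move=> k x y.
- rewrite leNgt; apply/negP => w2; apply: noopt; exists (w.2^-1 *: w.1).
  rewrite scalarZ // ler_pdivrMl //; split.
    by move=> i; rewrite scalarZ // ler_pdivrMl //;
      have := aw (Some i) isT => /=; lra.
  by have := aw None isT => /=; lra.
have key w : (forall i, g i w <= gamma i) -> 1 <= u None * (f w - inf A).
  move=> gw; have := fu (w, 1 : R^o); rewrite big_option /= mulr1.
  have : \sum_i u (Some i) * (g i w + - gamma i * 1) <= 0.
    by apply: sumr_le0 => i _; rewrite mulr_ge0_le0 // mulr1 subr_le0.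
  by move=> H1 H2; rewrite {1}H2 gerDl.
have uN : 0 < u None.
  rewrite lt_neqAle u0 eq_sym andbT; apply/eqP => uN.
  by have := key _ gw0; rewrite uN mul0r ler10.
have : inf A + (u None)^-1 <= inf A.
  apply: lb_le_inf; first exact: infA.1.
  by move=> _ [w gw <-]; rewrite -lerBrDl -[leLHS]mulr1 ler_pdivrMl // key.
by rewrite gerDl leNgt invr_gt0 uN.
Qed.

End LinearProgram.

(** * Coordinates and limits *)

Section Coordinates.
Context (R : realType).

Lemma scalar_coord n (j : 'I_n) : scalar (fun x : 'cV[R]_n => x j 0).
Proof. by move=> a u v; rewrite !mxE. Qed.

Lemma scalar_coord_mulmx m n (D : 'M[R]_(m, n)) i :
  scalar (fun x : 'cV[R]_n => (D *m x) i 0).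
Proof. by move=> a u v; rewrite mulmxDr -scalemxAr !mxE. Qed.

Lemma scalar_dot n (w : 'cV[R]_n) : scalar (dot w).
Proof.
move=> a u v; rewrite /dot mulr_sumr -big_split /=.
by apply: eq_bigr => j _; rewrite !mxE; ring.
Qed.

Lemma dotC n (x y : 'cV[R]_n) : dot x y = dot y x.
Proof. by apply: eq_bigr => j _; rewrite mulrC. Qed.

Lemma dot_delta n (x : 'cV[R]_n) k : dot (delta_mx k 0) x = x k 0.
Proof.
rewrite /dot (bigD1 k) //= mxE !eqxx mul1r big1 ?addr0 // => j jk.
by rewrite mxE (negbTE jk) mul0r.
Qed.

Lemma normr_coord_le n (x : 'cV[R]_n) j : `|x j 0| <= `|x|.
Proof.
rewrite [`|x|]mx_normrE.
by apply: (le_bigmax _ (fun ij : 'I_n * 'I_1 => `|x ij.1 ij.2|) (j, 0)).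
Qed.

End Coordinates.

Section Limits.
Context (R : realType).

Lemma cvg_sum (T I : Type) (r : seq I) (G : set_system T) (f : I -> T -> R)
    (l : I -> R) : Filter G -> (forall i, f i x @[x --> G] --> l i) ->
  \sum_(i <- r) f i x @[x --> G] --> \sum_(i <- r) l i.
Proof.
move=> FG fl.
by apply: (@cvg_big R I +%R 0 xpredT (@add_continuous R)) => // i _; exact: fl.
Qed.

Lemma cvg_coord (n : nat) (z : nat -> 'cV[R]_n) (zbar : 'cV[R]_n) j :
  z @ \oo --> zbar -> z k j 0 @[k --> \oo] --> zbar j 0.
Proof. move=> zz; have := @coord_continuous R n 1 j 0 zbar.
exact: (@cvg_comp _ _ _ z (fun x : 'cV[R]_n => x j 0) _ _ _ zz). Qed.

Lemma cvg_dot (n : nat) (w : 'cV[R]_n) (z : nat -> 'cV[R]_n) (zbar : 'cV[R]_n) :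
  z @ \oo --> zbar -> dot w (z k) @[k --> \oo] --> dot w zbar.
Proof.
move=> zz; apply: cvg_sum => j; apply: cvgM; first exact: cvg_cst.
exact: cvg_coord.
Qed.

Lemma cvg_coord_mulmx (m n : nat) (D : 'M[R]_(m, n)) (z : nat -> 'cV[R]_n)
    (zbar : 'cV[R]_n) i :
  z @ \oo --> zbar -> (D *m z k) i 0 @[k --> \oo] --> (D *m zbar) i 0.
Proof.
move=> zz; rewrite mxE; under eq_cvg do rewrite mxE.
apply: cvg_sum => j; apply: cvgM; first exact: cvg_cst.
exact: cvg_coord.
Qed.

Lemma cvg_enorm (n : nat) (u : nat -> 'cV[R]_n) (l : 'cV[R]_n) :
  (forall j, u t j 0 @[t --> \oo] --> l j 0) ->
  enorm (u t - l) @[t --> \oo] --> (0 : R).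
Proof.
move=> ul.
have sq0 : \sum_(j < n) (u t - l) j 0 ^+ 2 @[t --> \oo] -->
    \sum_(j < n) (l j 0 - l j 0) ^+ 2.
  apply: cvg_sum => j; under eq_cvg do rewrite !mxE expr2.
  by rewrite expr2; apply: cvgM; (apply: cvgB; [exact: ul|exact: cvg_cst]).
rewrite [X in _ --> X]big1 in sq0; last by move=> j _; rewrite subrr expr0n.
have := cvg_comp _ _ sq0 (@sqrt_continuous R 0).
by rewrite sqrtr0.
Qed.

End Limits.

(** * Hulls of mixed-integer sets *)

Section Hull.
Context (R : realType) (n L : nat) (F : 'I_L -> 'cV[R]_n).

Definition hull : set 'cV[R]_n :=
  [set z | exists u : 'I_L -> R,
     [/\ forall j, 0 <= u j, \sum_j u j = 1 & z = \sum_j u j *: F j]].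

(** Farkas' lemma for the functionals (w, t) |-> dot w (F j) - t: the weights it
returns are those of a convex combination, as the coefficient of t shows. *)
Lemma hull_dual z :
  hull z <-> forall w t, (forall j, dot w (F j) <= t) -> dot w z <= t.
Proof.
split=> [[u [u0 u1 ->]] w t h|h].
  rewrite (scalar_sum _ _ (scalar_dot w)) -[leRHS]mul1r -u1 mulr_suml.
  by apply: ler_sum => j _; rewrite (scalarZ _ _ (scalar_dot w)) ler_wpM2l.
pose a j (w : 'cV[R]_n * R^o) := dot w.1 (F j) - (w.2 : R).
have [||w aw|u [u0 fu]] := @farkas R ('cV[R]_n * R^o)%type _ predT a
    (fun w => dot w.1 z - (w.2 : R)).
- move=> j k x y; rewrite /a.
  have -> : (k *: x + y).2 = k * (x.2 : R) + y.2 :> R by [].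
  by rewrite dotC (scalar_dot _ _ _ _) !(dotC (F j)); ring.
- move=> k x y.
  have -> : (k *: x + y).2 = k * (x.2 : R) + y.2 :> R by [].
  by rewrite dotC (scalar_dot _ _ _ _) !(dotC z); ring.
- by rewrite subr_le0; apply: h => j; rewrite -subr_le0; exact: aw.
exists u; split=> //.
  have := fu (0, 1 : R^o); rewrite /a /= dotC (scalar0 (scalar_dot _)).
  under eq_bigr do rewrite dotC (scalar0 (scalar_dot _)) sub0r mulrN1.
  by rewrite sumrN sub0r => /oppr_inj.
apply/colP => k; have := fu (delta_mx k 0, 0 : R^o).
rewrite /a /= dot_delta subr0 summxE => ->.
by apply: eq_bigr => j _; rewrite dot_delta subr0 mxE.
Qed.

Lemma hull_convex x y k : 0 <= k -> k <= 1 -> hull x -> hull y ->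
  hull (k *: x + (1 - k) *: y).
Proof.
move=> k0 k1 /hull_dual hx /hull_dual hy; apply/hull_dual => w t h.
rewrite (scalar_dot _ _ _ _) (scalarZ _ _ (scalar_dot w)).
have := hx w t h; have := hy w t h; nra.
Qed.

Lemma convex_set_conv (A : set 'cV[R]_n) x y k :
  @convex_set R 'cV[R]_n A -> 0 <= k -> k <= 1 -> A x -> A y ->
  A (k *: x + (1 - k) *: y).
Proof.
move=> cA k0 k1 Ax Ay.
by have := cA x y (Itv01 k0 k1); rewrite !inE; apply.
Qed.

(** Convexity concerns two points at a time, so the combination is built one point
after the other, each partial sum being divided by its total weight. *)
Lemma hull_min (A : set 'cV[R]_n) : @convex_set R 'cV[R]_n A ->
  (forall j, A (F j)) -> hull `<=` A.
Proof.
move=> cA AF _ [u [u0 u1 ->]].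
have key (r : seq 'I_L) : 0 < \sum_(j <- r) u j ->
    A ((\sum_(j <- r) u j)^-1 *: \sum_(j <- r) u j *: F j).
  elim: r => [|k r IH]; first by rewrite big_nil ltxx.
  rewrite !big_cons; set s := \sum_(j <- r) u j.
  set z := \sum_(j <- r) u j *: F j => us.
  have s0 : 0 <= s by apply: sumr_ge0.
  move: (s0); rewrite le_eqVlt => /orP[/eqP s00|sp].
    have -> : z = 0.
      rewrite /z big_seq; apply: big1 => j jr.
      suff -> : u j = 0 by rewrite scale0r.
      apply/eqP; rewrite eq_le u0 andbT s00 /s.
      by rewrite (big_rem j) //= lerDl sumr_ge0.
    rewrite -s00 !addr0 in us *.
    by rewrite scalerA mulVf ?scale1r ?gt_eqF.
  have := @convex_set_conv A (F k) (s^-1 *: z) (u k / (u k + s)) cA.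
  have -> : 1 - u k / (u k + s) = s / (u k + s).
    by field; rewrite gt_eqF.
  rewrite scalerA mulrAC mulfV ?gt_eqF // mul1r scalerDr scalerA.
  rewrite [X in X *: F k]mulrC; apply=> //; last exact: IH.
    by rewrite divr_ge0 // ltW.
  by rewrite ler_pdivrMr // mul1r lerDl.
by have := key (index_enum _); rewrite u1 invr1 scale1r; apply.
Qed.

(** By [hull_dual] the support function determines the hull, so it is enough that
the points F attain it. *)
Lemma conv_hull_support (X : set 'cV[R]_n) :
  (forall j, X (F j)) ->
  (forall w x, X x -> exists j, dot w x <= dot w (F j)) ->
  conv_hull X = hull.
Proof.
move=> XF h; apply/seteqP; split.
  apply: smallest_sub.
    move=> x y k; rewrite !inE => hx hy.
    exact: (hull_convex (ge0 k) (le1 k) hx hy).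
  move=> x Xx; apply/hull_dual => w t wt.
  by have [j wj] := h w x Xx; apply: le_trans wj (wt j).
move=> z hz A [cA XA]; apply: (hull_min cA) hz => j; exact/XA/XF.
Qed.

Lemma hull_cvg (z : nat -> 'cV[R]_n) (zbar : 'cV[R]_n) :
  (forall t, hull (z t)) ->
  z @ \oo --> zbar -> hull zbar.
Proof.
move=> hz zz; apply/hull_dual => w t wt.
apply: (ler_cvg_to (cvg_dot (w := w) zz) (cvg_cst t)); apply: nearW => k.
by have /hull_dual := hz k; apply.
Qed.

End Hull.

(** On the slice of X with a given integer part, a linear functional is maximal at
some y; by complementary slackness it takes the same value at every point of the
slice where the rows that are tight at y are tight.  Hence one point for each
pair of a set of rows and an integer part is enough to attain the support
function, and P being bounded leaves finitely many pairs.  Repeating x0 allows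
any larger number of points, so that several agents can share one index type. *)
Lemma mixed_integer_hull (R : realType) (p q : nat) (P : set 'cV[R]_(p + q)) x0 :
  polyhedron P -> compact P -> mixed_integer P x0 ->
  exists L0, forall L, (L0 <= L)%N -> exists F : 'I_L -> 'cV[R]_(p + q),
    conv_hull (mixed_integer P) = hull F.
Proof.
move=> [m [D [d PE]]] cP Xx0.
have [B PB] : exists B : nat, forall x, P x -> forall j, `|x j 0| <= B%:R.
  have [C [Creal PC]] := compact_bounded cP.
  exists (Num.bound `|C + 1|) => x Px j; apply: le_trans (normr_coord_le x j) _.
  have /(le_trans (PC (C + 1) _ x Px)) : C + 1 <= (Num.bound `|C + 1|)%:R.
    by apply: le_trans (ler_norm _) _; by rewrite ltW // archi_boundP.
  by apply; rewrite ltrDl.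
pose T := ({set 'I_m} * {ffun 'I_p -> 'I_(B + B).+1})%type.
pose kap (t : T) j : R := (t.2 j)%:R - B%:R.
pose face (t : T) := [set x | mixed_integer P x /\
  ((forall i, i \in t.1 -> (D *m x) i 0 = d i 0) /\
   forall j, x (lshift q j) 0 = kap t j)].
pose pt t := xget x0 (face t).
have Xpt t : mixed_integer P (pt t).
  by rewrite /pt; case: xgetP => [x _ []|].
pose s := [seq pt t | t <- enum {: T}].
exists (size s) => L sL; pose F (j : 'I_L) := nth x0 s j; exists F.
apply: conv_hull_support => [j|w x Xx].
  rewrite /F; have [js|?] := ltnP j (size s); last by rewrite nth_default.
  by have /mapP[t _ ->] := mem_nth x0 js.
suff [t xt] : exists t, dot w x <= dot w (pt t).
  have ts : pt t \in s by apply: map_f; rewrite mem_enum.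
  have tL : (index (pt t) s < L)%N by apply: leq_trans sL; rewrite index_mem.
  by exists (Ordinal tL); rewrite /F /= nth_index.
have [k xk] : exists k : {ffun 'I_p -> 'I_(B + B).+1},
    forall j, x (lshift q j) 0 = (k j)%:R - B%:R.
  suff /choice[k kP] : forall j, exists k : 'I_(B + B).+1,
      x (lshift q j) 0 = k%:R - B%:R.
    by exists [ffun j => k j] => j; rewrite ffunE.
  move=> j; have /intrP[a xa] := Xx.2 j.
  have := PB x Xx.1 (lshift q j); rewrite xa ler_norml => /andP[aB Ba].
  have aB' : 0 <= a + B by rewrite -(ler_int R) rmorphD /=; lra.
  have kB : (`|(a + B)%R|%N < (B + B).+1)%N.
    rewrite ltnS -lez_nat gez0_abs // -(ler_int R) PoszD !rmorphD /=.
    by rewrite lerD2r.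
  exists (Ordinal kB) => /=.
  have -> : (`|(a + B)%R|%N)%:R = (a + B)%:~R :> R.
    by rewrite pmulrn gez0_abs.
  by rewrite rmorphD /=; ring.
pose J := ('I_m + ('I_p + 'I_p))%type.
pose h (j : J) (y : 'cV[R]_(p + q)) := match j with
  | inl i => (D *m y) i 0
  | inr (inl j) => y (lshift q j) 0
  | inr (inr j) => - y (lshift q j) 0 end.
pose eta (j : J) := match j with
  | inl i => d i 0
  | inr (inl j) => (k j)%:R - B%:R
  | inr (inr j) => - ((k j)%:R - B%:R) end.
have sh j : scalar (h j).
  case: j => [i|[j|j]]; [exact: scalar_coord_mulmx|exact: scalar_coord|].
  by move=> a u v; rewrite /h !mxE; ring.
have sw : scalar (fun y => - dot w y).
  by move=> a u v; rewrite (scalar_dot _ _ _ _); ring.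
have feasE y : (forall j, h j y <= eta j) ->
    P y /\ forall j, y (lshift q j) 0 = (k j)%:R - B%:R.
  move=> hy; split; first by rewrite PE => i; exact: (hy (inl i)).
  move=> j; have := hy (inr (inl j)); have := hy (inr (inr j)).
  by rewrite /= lerN2 => h1 h2; apply/eqP; rewrite eq_le h1 h2.
have hx j : h j x <= eta j.
  case: j => [i|[j|j]] /=; rewrite ?xk //.
  by have := Xx.1; rewrite PE; apply.
have [y [hy ymin]] : exists y, (forall j, h j y <= eta j) /\
    forall y', (forall j, h j y' <= eta j) -> - dot w y <= - dot w y'.
  apply: (@lp_attained _ _ _ h eta _ sh sw (- \sum_j `|w j 0| * B%:R) x hx).
  move=> y hy; rewrite lerN2; apply: ler_sum => j _.
  apply: le_trans (ler_norm _) _; rewrite normrM ler_wpM2l //.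
  by apply: PB; exact: (feasE y hy).1.
pose t : T := ([set i | (D *m y) i 0 == d i 0]%SET, k).
have [Py yk] := feasE y hy.
have facey : face t y.
  split; first by split=> // j; rewrite yk rpredB // rpred_nat.
  by split=> // i; rewrite inE => /eqP.
have [_ [ptD ptk]] : face t (pt t) by apply: xgetPex; exists y.
exists t; apply: (@le_trans _ _ (dot w y)).
  by have := ymin x hx; rewrite lerN2.
have [||y' _|mu [mu0 muP0]] := @lp_multiplier R _ 'I_0 J (fun=> \0) (fun=> 0)
    h eta _ _ sh sw (- dot w y) y _ hy.
- by case.
- by case.
- exact: ymin.
have muP y' : - dot w y <= - dot w y' + \sum_j mu j * (h j y' - eta j).
  by apply: muP0; case.
have slack j : mu j * (h j y - eta j) = 0.
  have le0 i : mu i * (h i y - eta i) <= 0.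
    by rewrite mulr_ge0_le0 // subr_le0.
  have := muP y; rewrite lerDl => sum_ge0.
  apply/eqP; rewrite eq_le le0 /=; apply: le_trans sum_ge0 _.
  by rewrite (bigD1 j) //= gerDl; apply: sumr_le0.
(* The Lagrangian is affine and nonnegative with value 0 at y, so evaluating it
   at the reflection 2 y - pt t of pt t in y shows that it vanishes at pt t. *)
have := muP (2 *: y + - pt t).
rewrite big1 => [|j _].
  have sd := scalar_dot w.
  rewrite addr0 sd -[- pt t]scaleN1r (scalarZ _ _ sd); lra.
rewrite sh -[- pt t]scaleN1r (scalarZ _ _ (sh j)).
have /eqP := slack j; rewrite mulf_eq0 => /orP[/eqP ->|]; first by rewrite mul0r.
rewrite subr_eq0 => /eqP hyj.
suff -> : h j (pt t) = eta j by rewrite hyj; ring.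
case: j hyj => [i|[j|j]] /= hyj; rewrite ?ptk //.
by apply: ptD; rewrite inE hyj.
Qed.

(** * Duality for the network linear program *)

Section NetworkDuality.
Context (R : realType) (N S L : nat) (n : 'I_N -> nat).
Variables (F : forall i, 'I_L -> 'cV[R]_(n i)) (c : forall i, 'cV[R]_(n i)).
Variables (A : forall i, 'M[R]_(S, n i)) (beta : 'cV[R]_S) (m rho : R).
Arguments F : clear implicits.

Let V := ('M[R]_(N, L) * R^o)%type.
Let pt (w : V) i : 'cV[R]_(n i) := \sum_j w.1 i j *: F i j.
Let ov (w : V) : R := w.2.

Let ptE a u v i : pt (a *: u + v) i = a *: pt u i + pt v i.
Proof.
rewrite /pt scaler_sumr -big_split; apply: eq_bigr => j _ /=.
by rewrite !mxE scalerDl scalerA.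
Qed.

Let ovE a u v : ov (a *: u + v) = a * ov u + ov v.
Proof. by []. Qed.

Let I := option ('I_N * 'I_L + 'I_N * bool).
Let g (k : I) (w : V) : R := match k with
  | None => - ov w
  | Some (inl ij) => - w.1 ij.1 ij.2
  | Some (inr ib) => (-1) ^+ ib.2 * \sum_j w.1 ib.1 j end.
Let gamma (k : I) : R := match k with
  | Some (inr ib) => (-1) ^+ ib.2
  | _ => 0 end.
Let h (s : 'I_S) (w : V) : R := (\sum_i A i *m pt w i) s 0 - rho * ov w.
Let f (w : V) : R := \sum_i dot (c i) (pt w i) + m * ov w.

Let sg k : scalar (g k).
Proof.
case: k => [[ij|ib]|] a u v.
- by rewrite /g !mxE; ring.
- rewrite /g; under eq_bigr do rewrite !mxE.
  by rewrite big_split /= -mulr_sumr; ring.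
- by rewrite /g ovE; ring.
Qed.

Let sh s : scalar (h s).
Proof.
move=> a u v; rewrite /h ovE !summxE.
have -> : \sum_i (A i *m pt (a *: u + v) i) s 0 =
  a * \sum_i (A i *m pt u i) s 0 + \sum_i (A i *m pt v i) s 0.
  rewrite mulr_sumr -big_split; apply: eq_bigr => i _.
  by rewrite ptE (scalar_coord_mulmx _ _ _ _ _).
by ring.
Qed.

Let sf : scalar f.
Proof.
move=> a u v; rewrite /f ovE.
have -> : \sum_i dot (c i) (pt (a *: u + v) i) =
  a * \sum_i dot (c i) (pt u i) + \sum_i dot (c i) (pt v i).
  rewrite mulr_sumr -big_split; apply: eq_bigr => i _.
  by rewrite ptE (scalar_dot _ _ _ _).
by ring.
Qed.

Let gP w : (forall k, g k w <= gamma k) <->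
  [/\ forall i j, 0 <= w.1 i j, forall i, \sum_j w.1 i j = 1 & 0 <= ov w].
Proof.
split=> [H|[H1 H2 H3]].
  split=> [i j|i|].
  - by have := H (Some (inl (i, j))); rewrite /= oppr_le0.
  - have := H (Some (inr (i, true))); have := H (Some (inr (i, false))).
    rewrite /= expr0 expr1 !mul1r mulN1r lerN2 => h1 h2.
    by apply/eqP; rewrite eq_le h1 h2.
  - by have := H None; rewrite /= oppr_le0.
by case=> [[[i j]|[i b]]|] /=; rewrite ?oppr_le0 // H2 mulr1.
Qed.

Let pt_hull w : (forall k, g k w <= gamma k) -> forall i, hull (F i) (pt w i).
Proof. by move=> /gP[w0 w1 _] i; exists (w.1 i). Qed.

Let weights (z : forall i, 'cV[R]_(n i)) (v : R) :
  (forall i, hull (F i) (z i)) -> 0 <= v ->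
  exists w : V, [/\ forall k, g k w <= gamma k, forall i, pt w i = z i & ov w = v].
Proof.
move=> /choice[u uP] v0; exists (\matrix_(i, j) u i j, v).
split=> //; last first.
  by move=> i; have [_ _ ->] := uP i; apply: eq_bigr => j _; rewrite mxE.
apply/gP; split=> // [i j|i]; first by rewrite mxE; have [] := uP i.
have [_ <- _] := uP i; apply: eq_bigr => j _; exact: mxE.
Qed.

(** Points of the hulls are represented by matrices of weights, one row per agent,
which makes the problem a linear program.  The restricted problem is the case
rho = m = 0, where v plays no part; the local problem is the case of a single
agent with rho = 1 and m = M. *)
Lemma network_duality : 0 <= m ->
  (exists z v, [/\ forall i, hull (F i) (z i), 0 <= v &
     lev (\sum_i A i *m z i) (beta + const_mx (rho * v))]) ->
  exists z v mu, [/\ forall i, hull (F i) (z i), 0 <= v,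
     lev (\sum_i A i *m z i) (beta + const_mx (rho * v)), lev 0 mu &
     forall z' v', (forall i, hull (F i) (z' i)) -> 0 <= v' ->
       \sum_i dot (c i) (z i) + m * v <=
       \sum_i dot (c i) (z' i) + m * v' +
         dot mu (\sum_i A i *m z' i - (beta + const_mx (rho * v')))].
Proof.
move=> m0 [z0 [v0 [Kz0 v00 Az0]]].
have [w0 [gw0 zw0 vw0]] := weights Kz0 v00.
have hE w s : (h s w <= beta s 0) =
    ((\sum_i A i *m pt w i) s 0 <= (beta + const_mx (rho * ov w)) s 0).
  by rewrite /h !mxE lerBlDr.
pose g' (k : I + 'I_S) := match k with inl i => g i | inr s => h s end.
pose gamma' (k : I + 'I_S) := match k with inl i => gamma i | inr s => beta s 0 end.
have sg' k : scalar (g' k) by case: k.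
have g'P w : (forall k, g' k w <= gamma' k) <->
    (forall k, g k w <= gamma k) /\ (forall s, h s w <= beta s 0).
  split=> [H|[H1 H2] [k|s]]; [|exact: H1|exact: H2].
  by split=> k; [exact: (H (inl k))|exact: (H (inr k))].
have [||w [/g'P[gw hw] wmin]] := @lp_attained R V _ g' gamma' f sg' sf
    (- \sum_i \sum_j `|dot (c i) (F i j)|) w0.
- apply/g'P; split=> // s; rewrite hE vw0.
  by under eq_bigr do rewrite zw0; exact: Az0.
- move=> w /g'P[/gP[wge w1 wov] _]; rewrite /f -[leLHS]addr0 lerD ?mulr_ge0 //.
  rewrite -sumrN; apply: ler_sum => i _.
  rewrite -sumrN /pt (scalar_sum _ _ (scalar_dot _)); apply: ler_sum => j _.
  rewrite (scalarZ _ _ (scalar_dot _)) lerNl.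
  apply: le_trans (ler_norm _) _; rewrite normrN normrM ler_piMl //.
  by rewrite ger0_norm // -(w1 i) (bigD1 j) //= lerDl sumr_ge0.
have [|mu [mu0 muP]] := @lp_multiplier R V _ _ g gamma h (fun s => beta s 0) f
  sg sh sf (f w) w gw hw.
  by move=> w' gw' hw'; apply/wmin/g'P.
exists (pt w), (ov w), (\col_s mu s); split.
- exact: pt_hull.
- by have /gP[] := gw.
- by move=> s; rewrite -hE.
- by move=> s; rewrite !mxE.
- move=> z' v' Kz' v'0; have [w' [gw' zw' vw']] := weights Kz' v'0.
  have := muP w' gw'; rewrite /f /h vw'.
  have -> : \sum_i dot (c i) (pt w' i) = \sum_i dot (c i) (z' i).
    by apply: eq_bigr => i _; rewrite zw'.
  have -> : \sum_i A i *m pt w' i = \sum_i A i *m z' i.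
    by apply: eq_bigr => i _; rewrite zw'.
  move=> /le_trans; apply; rewrite le_eqVlt; apply/orP; left; apply/eqP.
  by congr (_ + _); apply: eq_bigr => s _; rewrite !mxE; ring.
Qed.

End NetworkDuality.

(** * Quasi-Fejer sequences *)

Section QuasiFejer.
Context (R : realType) (E : finType).

Lemma bounded_cluster (u : nat -> E -> R) C : (forall t e, `|u t e| <= C) ->
  exists p : E -> R, forall eps m, 0 < eps ->
    exists2 t, (m <= t)%N & forall e, `|u t e - p e| < eps.
Proof.
move=> uC; pose v t : 'rV[R]_#|E| := \row_k u t (enum_val k).
have cpt := @rV_compact R _ _ (fun _ : 'I_#|E| => @segment_compact R (- C) C).
have [|a [_ ca]] := cpt (v @ \oo) (fmap_proper_filter v _).
  by exists 0%N => // t _ k; rewrite mxE /= in_itv /= -ler_norml.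
exists (fun e => a 0 (enum_rank e)) => eps m eps0.
have [||_ [[t mt <-] [_ tb]]] := ca (v @` [set t | (m <= t)%N]) (ball a eps).
- by exists m => // t mt; exists t.
- exact: nbhsx_ballx.
exists t => // e; rewrite distrC.
by have := tb 0 (enum_rank e); rewrite /ball /= mxE enum_rankK.
Qed.

Definition dist2 (x y : E -> R) : R := \sum_e (x e - y e) ^+ 2.

Lemma coord_dist2 x y e : (x e - y e) ^+ 2 <= dist2 x y.
Proof. by rewrite /dist2 (bigD1 e) //= lerDl sumr_ge0 // => ? _; exact: sqr_ge0. Qed.

Lemma dist2_ge0 x y : 0 <= dist2 x y.
Proof. by apply: sumr_ge0 => e _; exact: sqr_ge0. Qed.

Variables (alpha g : nat -> R) (x : nat -> E -> R) (C : R) (Sol : set (E -> R)).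
Hypothesis alpha_ge0 : forall t, 0 <= alpha t.
Hypothesis alpha_div : \sum_(0 <= k < t) alpha k @[t --> \oo] --> +oo.
Hypothesis alpha_sq : cvg (\sum_(0 <= k < t) alpha k ^+ 2 @[t --> \oo]).
Hypothesis g_ge0 : forall t, 0 <= g t.
Hypothesis C_ge0 : 0 <= C.
Hypothesis descent : forall s t, Sol s ->
  dist2 (x t.+1) s <= dist2 (x t) s - alpha t * g t + C * alpha t ^+ 2.

Let sq t := \sum_(0 <= k < t) alpha k ^+ 2.
Let sql := limn sq.

Let sq_le t : sq t <= sql.
Proof.
apply: nondecreasing_cvgn_le => // a b ab.
rewrite /sq (big_cat_nat (leq0n a) ab) //= lerDl.
by apply: sumr_ge0 => k _; exact: sqr_ge0.
Qed.

Let sqS t : sq t.+1 = sq t + alpha t ^+ 2.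
Proof. by rewrite /sq big_nat_recr. Qed.

Let descent_sum s t : Sol s ->
  dist2 (x t) s + \sum_(0 <= k < t) alpha k * g k <= dist2 (x 0%N) s + C * sq t.
Proof.
move=> Ss; elim: t => [|t IH]; first by rewrite /sq !big_geq // mulr0.
rewrite sqS big_nat_recr //= mulrDr.
by have := descent t Ss; lra.
Qed.

Let descent_from s t k : Sol s ->
  dist2 (x (t + k)%N) s <= dist2 (x t) s + C * (sq (t + k) - sq t).
Proof.
move=> Ss; elim: k => [|k IH]; first by rewrite addn0; lra.
rewrite addnS; have := descent (t + k)%N Ss.
rewrite sqS.
have := mulr_ge0 (alpha_ge0 (t + k)) (g_ge0 (t + k)); lra.
Qed.

(** Otherwise the bounded sums of alpha k * g k would dominate a multiple of the
divergent sums of alpha k. *)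
Let g_small s eps m : Sol s -> 0 < eps -> exists2 t, (m <= t)%N & g t < eps.
Proof.
move=> Ss eps0; apply: contrapT => no.
have ge t : (m <= t)%N -> eps <= g t.
  by move=> mt; rewrite leNgt; apply/negP => lt; apply: no; exists t.
pose K := dist2 (x 0%N) s + C * sql.
pose Am := \sum_(0 <= k < m) alpha k.
have /cvgryPge /(_ (Am + K / eps + 1)) [M _ HM] := alpha_div.
have := HM (M + m)%N (leq_addr _ _).
rewrite /= (big_cat_nat (leq0n m) (leq_addl M m)) //= -/Am => H1.
have H2 : eps * \sum_(m <= k < M + m) alpha k <= K.
  apply: le_trans (_ : \sum_(0 <= k < M + m) alpha k * g k <= _).
    rewrite (big_cat_nat (leq0n m) (leq_addl M m)) //= mulr_sumr.
    rewrite -[leLHS]add0r lerD //.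
      by apply: sumr_ge0 => k _; rewrite mulr_ge0.
    by apply: ler_sum_nat => k /andP[mk _]; rewrite mulrC ler_wpM2l ?ge.
  have := descent_sum (M + m) Ss; have := dist2_ge0 (x (M + m)%N) s.
  by have := ler_wpM2l C_ge0 (sq_le (M + m)); rewrite /K; lra.
have : eps * (K / eps + 1) <= K by apply: le_trans H2; rewrite ler_wpM2l //; lra.
by rewrite mulrDr mulrCA divff ?gt_eqF // !mulr1; lra.
Qed.

(** Along times where g is small, the bounded sequence has a cluster point, which
is a solution by the closedness hypothesis.  The sequence comes back arbitrarily
close to it, and [descent_from] prevents it from leaving afterwards. *)
Lemma quasi_fejer_cvg s0 : Sol s0 ->
  (forall p, (forall eps, 0 < eps ->
     exists t, g t < eps /\ forall e, `|x t e - p e| < eps) -> Sol p) ->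
  exists p, Sol p /\ forall e, x t e @[t --> \oo] --> p e.
Proof.
move=> Ss0 closed.
have /choice[tau tauP] k : exists t, (k <= t)%N /\ g t < k.+1%:R^-1.
  have [|t kt gt] := @g_small s0 k.+1%:R^-1 k Ss0; first by rewrite invr_gt0.
  by exists t.
pose K := dist2 (x 0%N) s0 + C * sql.
have DK t : dist2 (x t) s0 <= K.
  apply: le_trans (_ : dist2 (x 0%N) s0 + C * sq t <= _).
    apply: le_trans (descent_sum t Ss0); rewrite lerDl.
    by apply: sumr_ge0 => k _; rewrite mulr_ge0.
  by rewrite /K lerD2l ler_wpM2l.
have xB t e : `|x t e| <= \sum_e `|s0 e| + (K + 1).
  have h1 : `|s0 e| <= \sum_e `|s0 e|.
    by rewrite [leRHS](bigD1 e) //= lerDl sumr_ge0.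
  have h2 : `|x t e - s0 e| <= K + 1.
    have := le_trans (coord_dist2 (x t) s0 e) (DK t).
    rewrite -real_normK ?num_real //; set a := `|_| => aK.
    by have := sqr_ge0 (a - 1); have := sqr_ge0 a; rewrite sqrrB1; lra.
  by have := ler_normD (x t e - s0 e) (s0 e); rewrite subrK; lra.
have [p pP] := bounded_cluster (fun k e => xB (tau k) e).
have Sp : Sol p.
  apply: closed => eps eps0.
  have [k ek tk] := pP eps (Num.bound eps^-1) eps0.
  exists (tau k); split=> //; apply: lt_le_trans (tauP k).2 _.
  rewrite invf_ple ?posrE //; apply: ltW.
  apply: lt_le_trans (archi_boundP _) _; first by rewrite invr_ge0 ltW.
  by rewrite ler_nat ltnW // ltnS.
exists p; split=> // e; apply/cvgrPdist_lt => eps eps0.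
pose del := eps ^+ 2 / 2.
have del0 : 0 < del by rewrite divr_gt0 // exprn_gt0.
have [m _ mP] : \forall t \near \oo, `|sql - sq t| < del / (C + 1).
  move/cvgrPdist_lt: alpha_sq; apply; by rewrite divr_gt0 // ltr_wpDl.
(* With d <= 1, coordinates within d give a squared distance of at most #|E| d. *)
pose d := Num.min 1 (del / (#|E|%:R + 1)).
have d0 : 0 < d by rewrite lt_min ltr01 divr_gt0 // ltr_wpDl.
have [k mk kd] := pP d m d0.
pose t0 := tau k.
have mt0 : (m <= t0)%N := leq_trans mk (tauP k).1.
have Dt0 : dist2 (x t0) p <= del.
  apply: (@le_trans _ _ (\sum_(e : E) d)).
    apply: ler_sum => e' _; have := kd e'; rewrite -/t0 => /ltW h.
    have d1 : d <= 1 by rewrite ge_min lexx.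
    rewrite -real_normK ?num_real //.
    by have := normr_ge0 (x t0 e' - p e'); nra.
  rewrite sumr_const -mulr_natl.
  apply: (@le_trans _ _ ((#|E|%:R + 1) * d)); first by rewrite ler_pM2r // lerDl.
  by rewrite mulrC -ler_pdivlMr ?ltr_wpDl // /d ge_min lexx orbT.
exists t0 => // t /= /subnKC <-.
have := descent_from t0 (t - t0) Sp.
have := coord_dist2 (x (t0 + (t - t0))%N) p e.
have := mP t0 mt0; have := sq_le (t0 + (t - t0)); have := sq_le t0.
set b := sq t0; set a := sq _; set z := x _ e => bl al /= /ltr_normlP[_ hb] h1 h2.
have h3 : C * (a - b) < del.
  apply: le_lt_trans (_ : C * (del / (C + 1)) < _).
    by rewrite ler_wpM2l //; lra.
  by rewrite mulrCA -[ltRHS]mulr1 ltr_pM2l // ltr_pdivrMr ?ltr_wpDl //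
    mul1r ltrDl.
have h4 : `|p e - z| ^+ 2 < eps ^+ 2.
  rewrite distrC real_normK ?num_real //.
  by apply: le_lt_trans h1 _; rewrite /del in h3 Dt0; lra.
by rewrite -(ltr_pXn2r (n := 2)) ?nnegrE // ltW.
Qed.

End QuasiFejer.

(** * Flows on the communication graph *)

Section Flows.
Context (R : realType) (N S : nat) (e : rel 'I_N).
Hypothesis sym_e : symmetric e.

(** All ordered pairs of agents are present, each with S coordinates; the adjacency
weight w discards the pairs that are not edges. *)
Definition edge := ('I_N * 'I_N * 'I_S)%type.

Let w i j : R := (e i j)%:R.

Let wC i j : w i j = w j i.
Proof. by rewrite /w sym_e. Qed.

Definition divergence (x : edge -> R) (i : 'I_N) : 'cV[R]_S :=
  \col_s \sum_j w i j * (x (i, j, s) - x (j, i, s)).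

(** The factor 1/2 compensates for the two orientations carried by each edge, so
that the divergence of this flow is the graph Laplacian of mu. *)
Definition half_gradient (mu : 'I_N -> 'cV[R]_S) (k : edge) : R :=
  2^-1 * (w k.1.1 k.1.2 * (mu k.1.1 k.2 0 - mu k.1.2 k.2 0)).

Lemma sum_edge (f : edge -> R) : \sum_k f k = \sum_i \sum_j \sum_s f (i, j, s).
Proof. by rewrite !pair_bigA; apply: eq_bigr => -[[i j] s]. Qed.

Lemma divergenceD x y i : divergence (fun k => x k + y k) i =
  divergence x i + divergence y i.
Proof.
apply/colP => s; rewrite !mxE -big_split; apply: eq_bigr => j _ /=; ring.
Qed.

Lemma divergenceB x y i : divergence (fun k => x k - y k) i =
  divergence x i - divergence y i.
Proof.
apply/colP => s; rewrite !mxE -sumrB; apply: eq_bigr => j _ /=; ring.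
Qed.

Lemma divergence0 i : divergence (fun=> 0) i = 0.
Proof. by apply/colP => s; rewrite !mxE big1 // => j _; ring. Qed.

Lemma divergenceZ a x i : divergence (fun k => a * x k) i = a *: divergence x i.
Proof.
apply/colP => s; rewrite !mxE mulr_sumr; apply: eq_bigr => j _; ring.
Qed.

Lemma sum_divergence x : \sum_i divergence x i = 0.
Proof.
apply/colP => s; rewrite summxE !mxE; under eq_bigr do rewrite mxE.
under eq_bigr do [under eq_bigr do rewrite mulrBr; rewrite sumrB].
rewrite sumrB [X in _ - X]exchange_big /= [X in _ - X](eq_bigr
  (fun i => \sum_j w i j * x (i, j, s))) ?subrr // => i _.
by apply: eq_bigr => j _; rewrite wC.
Qed.

Lemma divergence_sum (I : Type) (r : seq I) (x : I -> edge -> R) i :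
  divergence (fun k => \sum_(l <- r) x l k) i = \sum_(l <- r) divergence (x l) i.
Proof.
elim: r => [|l r IH].
  by rewrite big_nil -(divergence0 i); congr divergence; apply/funext => k;
     rewrite big_nil.
rewrite big_cons -IH -divergenceD; congr divergence; apply/funext => k.
by rewrite big_cons.
Qed.

(** The vector v is sent along a path between i and j, one edge at a time. *)
Lemma path_flow i j (v : 'cV[R]_S) : connect e i j ->
  exists x, forall k, divergence x k = ((k == i)%:R - (k == j)%:R) *: v.
Proof.
case/connectP => p; elim: p i => [|a p IH] i /=.
  move=> _ ->; exists (fun=> 0) => k.
  by rewrite divergence0 subrr scale0r.
case/andP => eia /IH{}IH /IH[x xP].
exists (fun k => x k + ((k.1.1 == i) && (k.1.2 == a))%:R * v k.2 0) => k.
rewrite divergenceD xP; apply/colP => s; rewrite !mxE /=.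
have -> : \sum_l w k l * (((k == i) && (l == a))%:R * v s 0 -
    ((l == i) && (k == a))%:R * v s 0) = ((k == i)%:R - (k == a)%:R) * v s 0.
  rewrite (eq_bigr (fun l => (l == a)%:R * (w k l * (k == i)%:R * v s 0) -
     (l == i)%:R * (w k l * (k == a)%:R * v s 0))); last first.
    by move=> l _; rewrite -!mulnb !natrM; ring.
  rewrite sumrB (bigD1 a) //= [in X in _ - X](bigD1 i) //= !eqxx.
  rewrite !big1 ?addr0; first last.
  - by move=> l /negbTE ->; rewrite mul0r.
  - by move=> l /negbTE ->; rewrite mul0r.
  have -> : w k a * (k == i)%:R = (k == i)%:R.
    by case: eqP => [->|]; rewrite ?mulr0 // /w eia mulr1.
  have -> : w k i * (k == a)%:R = (k == a)%:R.
    by case: eqP => [->|]; rewrite ?mulr0 // /w sym_e eia mulr1.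
  by rewrite !mul1r mulrBl.
ring.
Qed.

(** Each d i is routed between i and i0; what accumulates at i0 is the total, which
vanishes. *)
Lemma divergence_surj (i0 : 'I_N) (d : 'I_N -> 'cV[R]_S) :
  (forall i j, connect e i j) -> \sum_i d i = 0 ->
  exists x, forall i, divergence x i = d i.
Proof.
move=> conn d0.
have /choice[x xP] i := path_flow (d i) (conn i i0).
exists (fun k => \sum_i x i k) => k; rewrite divergence_sum.
under eq_bigr do rewrite xP scalerBl.
rewrite sumrB -scaler_sumr d0 scaler0 subr0 (bigD1 k) //= eqxx scale1r.
by rewrite big1 ?addr0 // => i; rewrite eq_sym => /negbTE ->; rewrite scale0r.
Qed.

(** Up to the factor 1/2, discrete gradient and divergence are adjoint. *)
Lemma half_gradient_dual mu x :
  \sum_k half_gradient mu k * x k = 2^-1 * \sum_i dot (mu i) (divergence x i).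
Proof.
rewrite sum_edge.
have -> : \sum_i \sum_j \sum_s half_gradient mu (i, j, s) * x (i, j, s) =
    2^-1 * (\sum_i \sum_j \sum_s w i j * mu i s 0 * x (i, j, s) -
            \sum_i \sum_j \sum_s w i j * mu j s 0 * x (i, j, s)).
  rewrite -sumrB mulr_sumr; apply: eq_bigr => i _.
  rewrite -sumrB mulr_sumr; apply: eq_bigr => j _.
  rewrite -sumrB mulr_sumr; apply: eq_bigr => s _.
  by rewrite /half_gradient /=; ring.
rewrite [X in _ - X]exchange_big -sumrB; congr (_ * _); apply: eq_bigr => i _.
rewrite -sumrB; under eq_bigr do rewrite -sumrB.
rewrite exchange_big /dot; apply: eq_bigr => s _.
rewrite mxE mulr_sumr; apply: eq_bigr => j _.
by rewrite (wC j i); ring.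
Qed.

Lemma half_gradient_bound (mu : 'I_N -> 'cV[R]_S) (M : R) :
  (forall i s, 0 <= mu i s 0 <= M) ->
  forall k, `|half_gradient mu k| <= M.
Proof.
move=> muM [[i j] s]; have /andP[i0 iM] := muM i s; have /andP[j0 jM] := muM j s.
rewrite /half_gradient /w /=; case: (e i j) => /=; last first.
  by rewrite mulr0n mul0r mulr0 normr0 (le_trans i0).
by rewrite mulr1n mul1r ler_norml; apply/andP; split; lra.
Qed.

Lemma divergence_half_gradient mu i :
  divergence (half_gradient mu) i = \sum_(j | e i j) (mu i - mu j).
Proof.
apply/colP => s; rewrite mxE summxE [RHS]big_mkcond; apply: eq_bigr => j _.
rewrite /half_gradient /= (wC j i) /w !mxE.
by case: (e i j); rewrite /= ?mulr1n ?mulr0n ?mul0r //; field.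
Qed.

Lemma dist2_half_gradient x y a mu :
  dist2 (fun k => x k + a * half_gradient mu k) y =
  dist2 x y + a * \sum_i dot (mu i) (divergence x i - divergence y i) +
  a ^+ 2 * \sum_k half_gradient mu k ^+ 2.
Proof.
have -> : \sum_i dot (mu i) (divergence x i - divergence y i) =
    2 * \sum_k half_gradient mu k * (x k - y k).
  rewrite half_gradient_dual mulrA divff ?mul1r ?pnatr_eq0 //.
  by apply: eq_bigr => i _; rewrite divergenceB.
rewrite /dist2 !mulr_sumr -!big_split; apply: eq_bigr => k _ /=; ring.
Qed.

End Flows.

(** * The local problem *)

Section LocalProblem.
Context (R : realType) (S n : nat).
Variables (X : set 'cV[R]_n) (c : 'cV[R]_n) (A : 'M[R]_(S, n)) (M : R).

Definition loc_val (y : 'cV[R]_S) : R :=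
  inf [set loc_cost c M zv | zv in loc_feasible X A y].

Lemma loc_optimal_val y zv : loc_optimal X c A M y zv -> loc_cost c M zv = loc_val y.
Proof.
move=> [fzv zvmin]; apply/eqP; rewrite eq_le; apply/andP; split.
  apply: lb_le_inf; first by exists (loc_cost c M zv), zv.
  by move=> _ [zv' fzv' <-]; exact: zvmin.
apply: ge_inf; last by exists zv.
by exists (loc_cost c M zv) => _ [zv' fzv' <-]; exact: zvmin.
Qed.

(** Once an optimal solution is known, the equality of infima in the definition of
a multiplier reduces to one real inequality: the other one is weak duality. *)
Lemma loc_multiplier_val y mu zv : loc_optimal X c A M y zv ->
  loc_multiplier X c A M y mu <->
  lev 0 mu /\ forall z v, conv_hull X z -> 0 <= v ->
    loc_cost c M zv <= loc_lagrangian c A M y mu (z, v).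
Proof.
move=> [fzv zvmin]; have [Kz v0 Az] := fzv.
have primal : ereal_inf [set (loc_cost c M zv)%:E | zv in loc_feasible X A y] =
    (loc_cost c M zv)%:E.
  apply/eqP; rewrite eq_le; apply/andP; split.
    by apply: ereal_inf_lbound; exists zv.
  by apply: le_ereal_inf_tmp => _ [zv' fzv' <-]; rewrite lee_fin; exact: zvmin.
rewrite /loc_multiplier primal; split=> -[mu0 h]; split=> //.
  move=> z v Kz' v0'; rewrite -lee_fin -h.
  by apply: ereal_inf_lbound; exists (z, v).
apply/eqP; rewrite eq_le; apply/andP; split; last first.
  by apply: le_ereal_inf_tmp => _ [[z v] [Kz' v0'] <-]; rewrite lee_fin; exact: h.
apply: (@le_trans _ _ (loc_lagrangian c A M y mu zv)%:E).
  by apply: ereal_inf_lbound; exists zv.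
rewrite lee_fin /loc_lagrangian gerDl; apply: sumr_le0 => s _.
apply: mulr_ge0_le0; first by have := mu0 s; rewrite mxE.
by have := Az s; rewrite !mxE; lra.
Qed.

(** If the coordinates of mu had a sum larger than M, the Lagrangian would tend to
-oo with growing violation. *)
Lemma loc_multiplier_bound y mu zv : loc_optimal X c A M y zv ->
  loc_multiplier X c A M y mu -> forall s, 0 <= mu s 0 <= M.
Proof.
move=> ozv /(loc_multiplier_val _ ozv)[mu0 h] s.
have mu0' s' : 0 <= mu s' 0 by have := mu0 s'; rewrite mxE.
rewrite mu0' /=; apply: (@le_trans _ _ (\sum_s mu s 0)).
  by rewrite (bigD1 s) //= lerDl sumr_ge0.
rewrite leNgt; apply/negP => lt; have [[Kz v0 Az] _] := ozv.
pose D := loc_lagrangian c A M y mu (zv.1, 0) - loc_cost c M zv.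
have E v : loc_lagrangian c A M y mu (zv.1, v) =
    loc_lagrangian c A M y mu (zv.1, 0) - v * (\sum_s mu s 0 - M).
  rewrite /loc_lagrangian /loc_cost /= /dot mulrBr.
  have -> : \sum_j mu j 0 * (A *m zv.1 - (y + const_mx v)) j 0 =
     \sum_j mu j 0 * (A *m zv.1 - (y + const_mx 0)) j 0 - v * \sum_s mu s 0.
    by rewrite mulr_sumr -sumrB; apply: eq_bigr => j _; rewrite !mxE; ring.
  ring.
have D0 : 0 <= D by rewrite /D subr_ge0; exact: h.
have d0 : 0 < \sum_s mu s 0 - M by rewrite subr_gt0.
have k0 : 0 <= (D + 1) / (\sum_s mu s 0 - M).
  by apply: divr_ge0; [exact: addr_ge0|exact: ltW].
have := h zv.1 _ Kz k0; rewrite E divfK ?gt_eqF //.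
by rewrite /D; lra.
Qed.

(** A multiplier at y is the opposite of a subgradient at y of the value
function. *)
Lemma loc_subgradient y y' mu zv zv' : loc_optimal X c A M y zv ->
  loc_multiplier X c A M y mu -> loc_optimal X c A M y' zv' ->
  loc_val y + dot mu (y - y') <= loc_val y'.
Proof.
move=> ozv /(loc_multiplier_val _ ozv)[mu0 h] ozv'.
rewrite -(loc_optimal_val ozv) -(loc_optimal_val ozv').
have [[Kz v0 Az] _] := ozv'.
have := h zv'.1 zv'.2 Kz v0; rewrite /loc_lagrangian -surjective_pairing /=.
suff : dot mu (A *m zv'.1 - (y + const_mx zv'.2)) <= - dot mu (y - y') by lra.
rewrite /dot -sumrN; apply: ler_sum => s _; rewrite -mulrN ler_wpM2l //.
  by have := mu0 s; rewrite mxE.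
by have := Az s; rewrite !mxE; lra.
Qed.

(** A large violation makes any point of the hull feasible, and M >= 0 bounds the
cost from below. *)
Lemma loc_solvable L (F : 'I_L -> 'cV[R]_n) : conv_hull X = hull F ->
  conv_hull X !=set0 -> 0 <= M ->
  forall y, exists zv mu, loc_optimal X c A M y zv /\ loc_multiplier X c A M y mu.
Proof.
move=> XF [z0 Kz0] M0 y.
have [|z [v [mu [Kz v0 Az mu0 h]]]] := @network_duality R 1 S L (fun=> n)
    (fun=> F) (fun=> c) (fun=> A) y M 1 M0.
  exists (fun=> z0), (\sum_s `|(A *m z0 - y) s 0|); split.
  - by move=> _; rewrite -XF.
  - exact: sumr_ge0.
  - move=> s; rewrite big_ord1 mul1r [in leRHS]mxE [const_mx _ _ _]mxE.
    rewrite -lerBlDl (bigD1 s) //= -[leLHS]addr0.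
    apply: lerD; last exact: sumr_ge0.
    by apply: le_trans (ler_norm _) _; rewrite !mxE.
rewrite !big_ord1 mul1r in Az h.
have ozv : loc_optimal X c A M y (z 0, v).
  split; first by split=> //=; rewrite XF.
  move=> [z' v'] [/= Kz' v0' Az'].
  rewrite XF in Kz'; have := h (fun=> z') v' (fun=> Kz') v0'.
  rewrite !big_ord1 mul1r /loc_cost /= => /le_trans; apply.
  rewrite gerDl; apply: sumr_le0 => s _.
  apply: mulr_ge0_le0; first by have := mu0 s; rewrite mxE.
  by have := Az' s; rewrite !mxE; lra.
exists (z 0, v), mu; split=> //; apply/(loc_multiplier_val _ ozv); split=> //.
rewrite XF => z' v' Kz' v0'.
by have := h (fun=> z') v' (fun=> Kz') v0'; rewrite !big_ord1 mul1r.
Qed.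

End LocalProblem.

(** * Exact penalty *)

Lemma add_const_mxE (R : realType) S (y : 'cV[R]_S) v s :
  (y + const_mx v) s 0 = y s 0 + v.
Proof. by rewrite !mxE. Qed.

Section Network.
Context (R : realType) (N S L : nat) (n : 'I_N -> nat).
Variables (X : forall i, set 'cV[R]_(n i)) (c : forall i, 'cV[R]_(n i)).
Arguments X : clear implicits.
Variables (A : forall i, 'M[R]_(S, n i)) (b sigma : 'cV[R]_S).
Variable F : forall i, 'I_L -> 'cV[R]_(n i).
Arguments F : clear implicits.
Hypothesis XF : forall i, conv_hull (X i) = hull (F i).

(** An optimal solution with a multiplier of the coupling constraint. *)
Definition lp_certificate (zs : forall i, 'cV[R]_(n i)) (nu : 'cV[R]_S) : Prop :=
  [/\ lp_optimal X c A b sigma zs, lev 0 nu &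
    forall z, (forall i, conv_hull (X i) (z i)) ->
      \sum_i dot (c i) (zs i) <=
      \sum_i dot (c i) (z i) + dot nu (\sum_i A i *m z i - (b - sigma))].

Lemma lp_certificate_exists : lp_feasible X A b sigma !=set0 ->
  exists zs nu, lp_certificate zs nu.
Proof.
move=> [z0 [Az0 Kz0]].
have const0 v' : @const_mx R S 1 (0 * v') = 0.
  by rewrite mul0r; apply/colP => s; rewrite !mxE.
have [||zs [v [nu [Kz v0 Az nu0 h]]]] := @network_duality R N S L n F c A
    (b - sigma) 0 0.
- exact: lexx.
- exists z0, 0; split=> [i||]; rewrite -?XF //.
  by rewrite const0 addr0.
rewrite const0 addr0 in Az; rewrite mul0r addr0 in h.
have h' z : (forall i, conv_hull (X i) (z i)) ->
      \sum_i dot (c i) (zs i) <=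
      \sum_i dot (c i) (z i) + dot nu (\sum_i A i *m z i - (b - sigma)).
  move=> Kz'; have := h z 0; rewrite const0 !addr0 mul0r addr0.
  by apply=> // i; rewrite -XF.
exists zs, nu; split=> //; split; first by split=> // i; rewrite XF.
move=> z [Az' Kz']; apply: le_trans (h' z Kz') _.
rewrite gerDl; apply: sumr_le0 => s _.
apply: mulr_ge0_le0; first by have := nu0 s; rewrite mxE.
by have := Az' s; rewrite !mxE; lra.
Qed.

Variables (zs : forall i, 'cV[R]_(n i)) (nu : 'cV[R]_S) (M : R).
Hypothesis cert : lp_certificate zs nu.
Hypothesis nuM : 1 + \sum_s nu s 0 <= M.

Let opt : R := \sum_i dot (c i) (zs i).
Let phi i y := loc_val (X i) (c i) (A i) M y.

Lemma penalty_ge0 : 0 <= M.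
Proof.
apply: le_trans nuM; apply: addr_ge0 => //; apply: sumr_ge0 => s _.
by have [_ /(_ s)] := cert; rewrite mxE.
Qed.

(** Relaxing the coupling constraint by sum_i v_i in every coordinate lowers the
cost by at most (sum_s nu s) * sum_i v_i, and M exceeds this rate by at least 1. *)
Lemma exact_penalty (y : 'I_N -> 'cV[R]_S) (zv : forall i, 'cV[R]_(n i) * R) :
  \sum_i y i = b - sigma ->
  (forall i, loc_feasible (X i) (A i) (y i) (zv i)) ->
  opt + \sum_i (zv i).2 <= \sum_i loc_cost (c i) M (zv i).
Proof.
move=> sy fzv; have [_ nu0 /(_ (fun i => (zv i).1))] := cert.
have Kz i : conv_hull (X i) (zv i).1 by have [] := fzv i.
move=> /(_ Kz); rewrite -/opt => h.
have v0 : 0 <= \sum_i (zv i).2 by apply: sumr_ge0 => i _; have [] := fzv i.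
have slack : dot nu (\sum_i A i *m (zv i).1 - (b - sigma)) <=
    (\sum_s nu s 0) * \sum_i (zv i).2.
  rewrite /dot mulr_suml; apply: ler_sum => s _.
  apply: ler_wpM2l; first by have := nu0 s; rewrite mxE.
  rewrite -sy -sumrB summxE; apply: ler_sum => i _.
  by have [_ _ /(_ s)] := fzv i; rewrite !mxE; lra.
rewrite /loc_cost big_split /= -mulr_sumr.
by have := ler_wpM2r v0 nuM; lra.
Qed.

Hypothesis solvable : forall i y, exists zv mu,
  loc_optimal (X i) (c i) (A i) M y zv /\ loc_multiplier (X i) (c i) (A i) M y mu.

Lemma loc_val_le i y zv : loc_feasible (X i) (A i) y zv ->
  phi i y <= loc_cost (c i) M zv.
Proof.
move=> fzv; have [zv' [_ [ozv _]]] := solvable i y.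
by rewrite /phi -(loc_optimal_val ozv); apply: ozv.2.
Qed.

Lemma sum_loc_val_ge (y : 'I_N -> 'cV[R]_S) : \sum_i y i = b - sigma ->
  opt <= \sum_i phi i (y i).
Proof.
move=> sy.
pose zv i := sval (cid (solvable i (y i))).
have ozv i : loc_optimal (X i) (c i) (A i) M (y i) (zv i).
  by rewrite /zv; case: cid => w [mu []].
have := exact_penalty sy (fun i => (ozv i).1).
have -> : \sum_i loc_cost (c i) M (zv i) = \sum_i phi i (y i).
  by apply: eq_bigr => i _; exact: loc_optimal_val.
by apply: le_trans; rewrite lerDl; apply: sumr_ge0 => i _; have [[]] := ozv i.
Qed.

(** Every agent gets the resource that its part of zs uses; agent i0 also gets what
is left. *)
Lemma optimal_allocation (i0 : 'I_N) : exists ys : 'I_N -> 'cV[R]_S,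
  \sum_i ys i = b - sigma /\ \sum_i phi i (ys i) = opt.
Proof.
have [[[Azs Kzs] _] _ _] := cert.
pose d := b - sigma - \sum_i A i *m zs i.
pose ys i := A i *m zs i + (if i == i0 then d else 0).
have sy : \sum_i ys i = b - sigma.
  rewrite big_split /= -big_mkcond big_pred1_eq /d addrC subrK //.
exists ys; split=> //; apply/eqP; rewrite eq_le sum_loc_val_ge // andbT.
apply: ler_sum => i _.
have fi : loc_feasible (X i) (A i) (ys i) (zs i, 0).
  split=> //= s; rewrite add_const_mxE addr0 /ys.
  rewrite [in leRHS]mxE lerDl; case: ifP => _; last by rewrite mxE.
  by have := Azs s; rewrite /d [leRHS]mxE; rewrite !mxE; lra.
by have := loc_val_le fi; rewrite /loc_cost /= mulr0 addr0.
Qed.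

(** A value of opt leaves no room for violations in [exact_penalty], so the local
solutions are feasible for the master subproblems, whose values are always at
least phi. *)
Lemma master_optimal_val (y : 'I_N -> 'cV[R]_S) : \sum_i y i = b - sigma ->
  \sum_i phi i (y i) = opt -> master_optimal X c A b sigma y.
Proof.
move=> sy py.
have lb i y' z : pi_feasible (X i) (A i) y' z -> phi i y' <= dot (c i) z.
  move=> [Kz Az]; have := @loc_val_le i y' (z, 0); rewrite /loc_cost /= mulr0 addr0.
  apply; split=> //= s; rewrite add_const_mxE addr0; exact: Az.
pose zv i := sval (cid (solvable i (y i))).
have ozv i : loc_optimal (X i) (c i) (A i) M (y i) (zv i).
  by rewrite /zv; case: cid => w [mu []].
have v0 i : (zv i).2 = 0.
  have := exact_penalty sy (fun i => (ozv i).1).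
  have -> : \sum_i loc_cost (c i) M (zv i) = opt.
    by rewrite -py; apply: eq_bigr => j _; exact: loc_optimal_val.
  have vge j : 0 <= (zv j).2 by have [[]] := ozv j.
  rewrite gerDl => vle; apply/eqP; rewrite eq_le vge andbT.
  by apply: le_trans vle; rewrite (bigD1 i) //= lerDl sumr_ge0.
have pz i : pi_feasible (X i) (A i) (y i) (zv i).1.
  have [[Kz _ Az] _] := ozv i; split=> // s.
  by have := Az s; rewrite v0 add_const_mxE addr0.
split; first by split=> // i; exists (zv i).1.
move=> y' [sy' Yy']; apply: (@le_trans _ _ (\sum_i phi i (y' i))).
  rewrite (le_trans _ (sum_loc_val_ge sy')) // -py; apply: ler_sum => i _.
  rewrite /phi -(loc_optimal_val (ozv i)) /loc_cost v0 mulr0 addr0.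
  apply: ge_inf; last by exists (zv i).1.
  by exists (phi i (y i)) => _ [z fz <-]; exact: lb.
apply: ler_sum => i _; apply: lb_le_inf.
  by have [z fz] := Yy' i; exists (dot (c i) z), z.
by move=> _ [z fz <-]; exact: lb.
Qed.

(** * Convergence of the algorithm *)

Section Run.
Variables (e : rel 'I_N) (alpha : nat -> R) (y0 : 'I_N -> 'cV[R]_S) (i0 : 'I_N).
Hypotheses (sym_e : symmetric e) (conn : forall i j, connect e i j).
Hypothesis alpha_ge0 : forall t, 0 <= alpha t.
Hypothesis alpha_div : \sum_(0 <= k < t) alpha k @[t --> \oo] --> +oo.
Hypothesis alpha_sq : cvg (\sum_(0 <= k < t) alpha k ^+ 2 @[t --> \oo]).
Hypothesis sum_y0 : \sum_i y0 i = b - sigma.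

Lemma run_exists : exists y mu z, algorithm_run X c A e M alpha y0 y mu z.
Proof.
pose zv i y := sval (cid (solvable i y)).
pose mu i y := sval (cid (svalP (cid (solvable i y)))).
have zvmu i y : loc_optimal (X i) (c i) (A i) M y (zv i y) /\
    loc_multiplier (X i) (c i) (A i) M y (mu i y).
  by rewrite /zv /mu; exact: (svalP (cid (svalP (cid (solvable i y))))).
pose y := nat_rect (fun=> 'I_N -> 'cV[R]_S) y0 (fun t yt i =>
  yt i + alpha t *: \sum_(j | e i j) (mu i (yt i) - mu j (yt j))).
exists y, (fun t i => mu i (y t i)), (fun t i => (zv i (y t i)).1).
split=> // t i; first by have [] := zvmu i (y t i).
by exists (zv i (y t i)).2; rewrite -surjective_pairing; have [] := zvmu i (y t i).
Qed.

Variables (y mu : nat -> 'I_N -> 'cV[R]_S) (z : nat -> forall i, 'cV[R]_(n i)).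
Hypothesis run : algorithm_run X c A e M alpha y0 y mu z.

(** The flow driven by the half gradients of the multipliers; its divergence is
y t - y0. *)
Let x := nat_rect (fun=> edge N S -> R) (fun=> 0)
  (fun t xt k => xt k + alpha t * half_gradient e (mu t) k).

Let yE t i : y t i = y0 i + divergence e (x t) i.
Proof.
have [yi _ _ ys] := run.
elim: t => [|t IH]; first by rewrite yi /= divergence0 addr0.
by rewrite ys IH /= divergenceD divergenceZ divergence_half_gradient // addrA.
Qed.

Let sum_flow x' : \sum_i (y0 i + divergence e x' i) = b - sigma.
Proof. by rewrite big_split /= sum_divergence // addr0. Qed.

Lemma run_sum t : \sum_i y t i = b - sigma.
Proof. by under eq_bigr do rewrite yE; exact: sum_flow. Qed.

Let mu_bound t i s : 0 <= mu t i s 0 <= M.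
Proof.
have [_ /(_ t i) mum /(_ t i)[v ozv] _] := run.
exact: (loc_multiplier_bound ozv mum).
Qed.

Let gap t : R := \sum_i phi i (y t i) - opt.

Let gap_ge0 t : 0 <= gap t.
Proof. by rewrite subr_ge0 sum_loc_val_ge // run_sum. Qed.

Let gap_le t ys : \sum_i phi i (ys i) = opt ->
  gap t <= - \sum_i dot (mu t i) (y t i - ys i).
Proof.
move=> pys; rewrite /gap -pys lerBlDr -lerBlDl opprK -big_split.
apply: ler_sum => i _ /=.
have [_ /(_ t i) mum /(_ t i)[v ozv] _] := run.
have [zv [_ [ozv' _]]] := solvable i (ys i).
exact: (loc_subgradient ozv mum ozv').
Qed.

Let Sol : set (edge N S -> R) :=
  [set p | \sum_i phi i (y0 i + divergence e p i) = opt].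

Let C : R := \sum_(k : edge N S) M ^+ 2.

Let descent s t : Sol s ->
  dist2 (x t.+1) s <= dist2 (x t) s - alpha t * gap t + C * alpha t ^+ 2.
Proof.
move=> Ss; rewrite /= dist2_half_gradient //; apply: lerD.
  rewrite lerD2l -mulrN ler_wpM2l // lerNr; apply: le_trans (gap_le t Ss) _.
  rewrite le_eqVlt; apply/orP; left; apply/eqP; congr (- _).
  by apply: eq_bigr => i _; rewrite yE opprD addrACA subrr add0r.
rewrite mulrC ler_wpM2r ?sqr_ge0 //; apply: ler_sum => k _.
rewrite -real_normK ?num_real // lerXn2r ?nnegrE ?penalty_ge0 //.
exact: (half_gradient_bound e (mu_bound t)).
Qed.

(** The closedness required by [quasi_fejer_cvg] comes from the multipliers eta at
the cluster point: the subgradient inequality there bounds the value at the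
cluster point by the value at a nearby iterate, up to the distance. *)
Let flow_cvg : exists p, Sol p /\ forall k, x t k @[t --> \oo] --> p k.
Proof.
have [ys [sys pys]] := optimal_allocation i0.
have [|s0 s0P] := @divergence_surj R N S e sym_e i0 (fun i => ys i - y0 i) conn.
  by rewrite sumrB sys sum_y0 subrr.
apply: (quasi_fejer_cvg alpha_ge0 alpha_div alpha_sq gap_ge0 _ descent (s0 := s0)).
- by apply: sumr_ge0 => k _; exact: sqr_ge0.
- by rewrite /Sol /= -pys; apply: eq_bigr => i _; rewrite s0P addrC subrK.
move=> p near_p; rewrite /Sol /=; apply/eqP; rewrite eq_le.
rewrite sum_loc_val_ge ?sum_flow // andbT.
pose yp i := y0 i + divergence e p i.
pose eta i := sval (cid (svalP (cid (solvable i (yp i))))).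
have etaP i : exists2 zv, loc_optimal (X i) (c i) (A i) M (yp i) zv &
    loc_multiplier (X i) (c i) (A i) M (yp i) (eta i).
  have [h1 h2] := svalP (cid (svalP (cid (solvable i (yp i))))).
  by exists (sval (cid (solvable i (yp i)))).
have etaM i s : 0 <= eta i s 0 <= M.
  by have [zv ozv em] := etaP i; exact: (loc_multiplier_bound ozv em).
pose K := 1 + 2 * \sum_(k : edge N S) M.
have K0 : 0 < K.
  rewrite /K ltr_wpDr // mulr_ge0 // sumr_ge0 // => k _; exact: penalty_ge0.
apply/ler_addgt0Pr => eps eps0.
have [t [gt xt]] := near_p (eps / K) (divr_gt0 eps0 K0).
have sub : \sum_i phi i (yp i) + \sum_i dot (eta i) (yp i - y t i) <= opt + gap t.
  rewrite /gap [leRHS]addrC subrK -big_split; apply: ler_sum => i _ /=.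
  have [zv ozv em] := etaP i; have [zv' [_ [ozv' _]]] := solvable i (y t i).
  exact: (loc_subgradient ozv em ozv').
have small : - \sum_i dot (eta i) (yp i - y t i) <=
    2 * \sum_(k : edge N S) M * (eps / K).
  have -> : - \sum_i dot (eta i) (yp i - y t i) =
      2 * \sum_k half_gradient e eta k * (x t k - p k).
    rewrite half_gradient_dual // mulrA divff ?mul1r ?pnatr_eq0 // -sumrN.
    apply: eq_bigr => i _; rewrite divergenceB yE /yp -[LHS]mulN1r.
    rewrite -(scalarZ _ _ (scalar_dot _)) scaleN1r; congr dot.
    by rewrite opprB opprD addrACA subrr add0r.
  rewrite ler_pM2l //; apply: ler_sum => k _.
  apply: le_trans (ler_norm _) _; rewrite normrM; apply: ler_pM => //.
    exact: (half_gradient_bound e etaM).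
  exact: ltW (xt k).
have E : eps / K + 2 * \sum_(k : edge N S) M * (eps / K) = eps.
  by rewrite -mulr_suml /K; field; rewrite gt_eqF.
by rewrite -/yp; move: gt sub small; lra.
Qed.

Lemma run_converges : exists ys, master_optimal X c A b sigma ys /\
  \sum_i phi i (ys i) = opt /\
  forall i s, y t i s 0 @[t --> \oo] --> ys i s 0.
Proof.
have [p [Sp xp]] := flow_cvg.
exists (fun i => y0 i + divergence e p i); split; [|split=> //].
  by apply: master_optimal_val => //; exact: sum_flow.
move=> i s; rewrite !mxE.
under eq_cvg do rewrite yE !mxE.
apply: cvgD; first exact: cvg_cst.
apply: cvg_sum => j; apply: cvgM; first exact: cvg_cst.
by apply: cvgB; exact: xp.
Qed.

(** The gap bounds every violation and the excess of the cost over opt, and the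
subgradient inequality at y t bounds the gap by M times the distance between y t
and its limit, which is del t. *)
Lemma run_limit_point zbar : seq_limit_point z zbar ->
  lp_optimal X c A b sigma zbar.
Proof.
move=> [h [h_incr hz]].
have [ys [[[sys _] _] [pys ycvg]]] := run_converges.
pose del t := \sum_i \sum_s M * `|y t i s 0 - ys i s 0|.
have del0 : del t @[t --> \oo] --> 0.
  have -> : 0 = \sum_(i < N) \sum_(s < S) M * `|ys i s 0 - ys i s 0| :> R.
    by rewrite big1 // => i _; rewrite big1 // => s _; rewrite subrr normr0 mulr0.
  apply: cvg_sum => i; apply: cvg_sum => s; apply: cvgM; first exact: cvg_cst.
  by apply: cvg_norm; apply: cvgB; [exact: ycvg|exact: cvg_cst].
have gap_del t : gap t <= del t.
  apply: le_trans (gap_le t pys) _; rewrite -sumrN; apply: ler_sum => i _.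
  rewrite /dot -sumrN; apply: ler_sum => s _.
  apply: le_trans (ler_norm _) _; rewrite normrN normrM !mxE ler_wpM2r //.
  by have /andP[m0 mM] := mu_bound t i s; rewrite ger0_norm.
have [_ _ ex_v _] := run.
pose lo t i := cid (ex_v t i).
pose v t i := sval (lo t i).
have ov t i : loc_optimal (X i) (c i) (A i) M (y t i) (z t i, v t i).
  exact: (svalP (lo t i)).
have vge t i : 0 <= v t i by have [[]] := ov t i.
have costE t : \sum_i loc_cost (c i) M (z t i, v t i) = opt + gap t.
  rewrite /gap [RHS]addrC subrK; apply: eq_bigr => i _; exact: loc_optimal_val.
have vdel t i : v t i <= del t.
  have := exact_penalty (run_sum t) (fun i => (ov t i).1).
  rewrite costE lerD2l /= => /le_trans/(_ (gap_del t)); apply: le_trans.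
  by rewrite (bigD1 i) //= lerDl sumr_ge0.
have h_oo : h k @[k --> \oo] --> \oo.
  apply/cvgnyPge => m; exists m => // k /= mk; apply: leq_trans mk _.
  by elim: k => // k IH; apply: leq_ltn_trans IH _; exact: h_incr.
have Kz i : conv_hull (X i) (zbar i).
  rewrite XF; apply: hull_cvg (hz i) => k; rewrite -XF.
  by have [[]] := ov (h k) i.
have delh : del (h k) @[k --> \oo] --> 0 by exact: (cvg_comp _ _ h_oo del0).
have feas : lp_feasible X A b sigma zbar.
  split=> // s; rewrite -sys !summxE; apply: ler_sum => i _.
  have lim1 := cvg_coord_mulmx (D := A i) (i := s) (hz i).
  have lim2 : y (h k) i s 0 + del (h k) @[k --> \oo] --> ys i s 0 + 0.
    by apply: cvgD => //; exact: (cvg_comp _ _ h_oo (ycvg i s)).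
  rewrite -[leRHS]addr0; apply: (ler_cvg_to lim1 lim2); apply: nearW => k.
  have [[_ _ Az] _] := ov (h k) i; have := Az s; rewrite add_const_mxE.
  by move=> /le_trans; apply; rewrite lerD2l; exact: vdel.
split=> // z' fz'; have [[_ zs_min] _ _] := cert.
apply: le_trans (zs_min z' fz'); rewrite -/opt -[leRHS]addr0.
have lim1 : \sum_i dot (c i) (z (h k) i) @[k --> \oo] -->
    \sum_i dot (c i) (zbar i).
  by apply: cvg_sum => i; exact: cvg_dot.
have lim2 : opt + del (h k) @[k --> \oo] --> opt + 0.
  by apply: cvgD => //; exact: cvg_cst.
apply: (ler_cvg_to lim1 lim2); apply: nearW => k.
apply: (@le_trans _ _ (opt + gap (h k))); last by rewrite lerD2l.
rewrite -costE; apply: ler_sum => i _; rewrite /loc_cost /= lerDl.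
by rewrite mulr_ge0 // penalty_ge0.
Qed.

End Run.
End Network.

Theorem mainTheorem1 (R : realType) (N S : nat) (p q : 'I_N -> nat)
  (P : forall i : 'I_N, set 'cV[R]_(p i + q i))
  (c : forall i : 'I_N, 'cV[R]_(p i + q i))
  (A : forall i : 'I_N, 'M[R]_(S, p i + q i))
  (b : 'cV[R]_S)
  (e : rel 'I_N)
  (alpha : nat -> R) (sigma : 'cV[R]_S) (y0 : 'I_N -> 'cV[R]_S)
  (X := fun i : 'I_N => mixed_integer (P i)) :
  (0 < N)%N ->
  (forall i, polyhedron (P i)) ->
  (forall i, P i !=set0) ->
  (forall i, compact (P i)) ->
  milp_feasible X A b !=set0 ->
  symmetric e -> irreflexive e -> (forall i j, connect e i j) ->
  (forall t, 0 <= alpha t) ->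
  (\sum_(0 <= k < t) alpha k @[t --> \oo] --> +oo) ->
  cvg (\sum_(0 <= k < t) alpha k ^+ 2 @[t --> \oo]) ->
  lev 0 sigma ->
  lp_feasible X A b sigma !=set0 ->
  \sum_i y0 i = b - sigma ->
  exists M0 : R, 0 < M0 /\ forall M : R, M0 <= M ->
    (exists y mu z, algorithm_run X c A e M alpha y0 y mu z) /\
    (forall y mu z, algorithm_run X c A e M alpha y0 y mu z ->
      [/\ forall t, \sum_i y t i = b - sigma,
          exists ystar : 'I_N -> 'cV[R]_S,
            master_optimal X c A b sigma ystar /\
            forall i, enorm (y t i - ystar i) @[t --> \oo] --> (0 : R)
        & forall zbar, seq_limit_point z zbar ->
            lp_optimal X c A b sigma zbar]).
Proof.
move=> N0 polyP _ cptP [x0 [_ Xx0]] sym_e _ conn a0 a_div a_sq _ feas sum_y0.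
pose L0 i := cid (mixed_integer_hull (polyP i) (cptP i) (Xx0 i)).
pose L := (\sum_i sval (L0 i))%N.
have L0L i : (sval (L0 i) <= L)%N by rewrite /L (bigD1 i) //= leq_addr.
pose F i := cid (svalP (L0 i) L (L0L i)).
have XF i : conv_hull (X i) = hull (sval (F i)) := svalP (F i).
have [zs [nu cert]] := lp_certificate_exists c XF feas.
have nu_ge0 : 0 <= \sum_s nu s 0.
  by apply: sumr_ge0 => s _; have [_ /(_ s)] := cert; rewrite mxE.
exists (1 + \sum_s nu s 0); split=> [|M nuM]; first by rewrite ltr_pwDl.
have M_ge0 : 0 <= M := penalty_ge0 cert nuM.
have X0 i : conv_hull (X i) !=set0.
  by exists (x0 i); apply: sub_gen_smallest; exact: Xx0.
have solv i y : exists zv mu, loc_optimal (X i) (c i) (A i) M y zv /\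
    loc_multiplier (X i) (c i) (A i) M y mu.
  exact: (loc_solvable (c i) (A i) (XF i) (X0 i) M_ge0).
split; first exact: run_exists.
move=> y mu z run; pose i0 := Ordinal N0.
split; first exact: (run_sum sym_e sum_y0 run).
  have [ys [ys_opt [_ ycvg]]] := run_converges cert nuM solv i0 sym_e conn a0
    a_div a_sq sum_y0 run.
  by exists ys; split=> // i; apply: cvg_enorm => s; exact: ycvg.
exact: (run_limit_point XF cert nuM solv i0 sym_e conn a0 a_div a_sq sum_y0 run).
Qed.
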